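(* Let $C(\mathcal{X},\mathcal{P},mQ)$ be an algebraic geometry code over $\mathbb{F}_q$ of length $n$ from a curve $\mathcal{X}$ of genus $g$, with $2g-1\le m<n$, and let $\Pi$ be a reliability matrix. Algebraic soft-decoding for AG codes with list size limited to $L$ produces a list that contains a codeword $\mathbf{c}\in C(\mathcal{X},\mathcal{P},mQ)$ if $$\frac{\langle\Pi,\lfloor\mathbf{c}\rfloor\rangle}{\sqrt{\langle\Pi,\Pi\rangle}}\ge\sqrt m\,\frac{1+\frac{\tilde\gamma+\sqrt{2\tilde\gamma}}{L\sqrt{1-\frac{2\tilde\gamma}{L}(1+\frac2L)}}}{1-\frac{1}{L\sqrt{1-\frac{2\tilde\gamma}{L}(1+\frac2L)}}\left(\frac{\sqrt q}{2\sqrt{\tilde R}}+\frac1{\tilde R}\right)}=\sqrt m\left(1+O\!\left(\tfrac1L\right)\right),$$ where $\tilde R=m/n$, $\tilde\gamma=g/m$, and the constant in $O(\cdot)$ depends only on $\tilde R$, $\tilde\gamma$ and $q$.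
   Context: AG code: for a curve $\mathcal{X}$ of genus $g$ over $\mathbb{F}_q$, distinct rational points $\mathcal{P}=\{P_1,\dots,P_n\}$ and a rational point $Q\notin\mathcal{P}$, $\mathcal{L}(mQ)$ is the space of rational functions with no poles except a pole of order $\le m$ at $Q$, and $C(\mathcal{X},\mathcal{P},mQ)=\{(f(P_1),\dots,f(P_n)):f\in\mathcal{L}(mQ)\}$. Let $\mathcal{K}_Q=\bigcup_i\mathcal{L}(iQ)$. A reliability matrix is a $q\times n$ matrix $\Pi=(\pi_{\alpha,j})$ whose columns are probability vectors indexed by $\mathbb{F}_q$; $\lfloor\mathbf{c}\rfloor$ is the $q\times n$ 0/1 matrix with a $1$ at $(\alpha,j)$ iff $c_j=\alpha$; $\langle A,B\rangle=\sum a_{ij}b_{ij}$. Algebraic soft-decoding (Koetter–Vardy) for AG codes: from $\Pi$ a nonnegative integer multiplicity matrix $M=(m_{\alpha,j})$ is computed with $M=\lambda\Pi-J$ for some $\lambda>0$ and a matrix $J$ with entries in $[0,1]$ (proportional allocation, with total multiplicity $s$); its cost is $C(M)=\frac12\sum_{\alpha,j}m_{\alpha,j}(m_{\alpha,j}+1)$ and one sets $L_m(M)=\frac{g+\sqrt{2m(C(M)+g)+g^2}}{m}$. With list size limited to $L$, $s$ is increased until $L\le L_m(M)<L+1$. Then one computes a nonzero $Q_M(Y)\in\mathcal{K}_Q[Y]$ of minimal $(1,m)$-weighted $Q$-valuation having a zero of multiplicity at least $m_{\alpha,j}$ at each point $(P_j,\alpha)$, and outputs the codewords $(f(P_1),\dots,f(P_n))$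 for all $f\in\mathcal{L}(mQ)$ such that $Y-f$ divides $Q_M(Y)$. Here the $(1,m)$-weighted $Q$-valuation of $\sum a_{ij}\phi_iY^j$ (with $\phi_i\in\mathcal{L}(iQ)\setminus\mathcal{L}((i-1)Q)$ for non-gaps $i$) is $\max\{i+jm:a_{ij}\neq0\}$, and multiplicity at $(P,\alpha)$ is measured by expanding $A(Y+\alpha)$ in a basis $\phi_{i,P}Y^j$ with $\phi_{i,P}$ of exact multiplicity $i$ at $P$ and requiring all coefficients with $i+j$ below the multiplicity to vanish.
   Formalization: The formal statement also assumes that the quantity under the square root and the denominator of the bound are positive; with a negative denominator the condition holds for every codeword and the claim is false (e.g. a Reed–Solomon code over F_3 with m=1, n=2, L=1). *)

(* Defs.v *)
From HB Require Import structures.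
From mathcomp Require Import all_boot all_order all_algebra.
From mathcomp Require Import reals.
From Stdlib Require List.
Set Implicit Arguments. Unset Strict Implicit. Unset Printing Implicit Defensive.
Import Order.TTheory GRing.Theory Num.Theory.
Local Open Scope ring_scope.

(* Algebraic function fields of one variable F / K over a finite field K,    *)
(* with K embedded in F by iota.  Places are identified with their          *)
(* normalized discrete valuations v : F -> int (convention v 0 = 0; the     *)
(* value at 0 is never used, "v(x) >= n" is always read through vge, i.e.   *)
(* in Z u {oo} with v(0) = oo).                                              *)

Section FunctionFields.
Variables (K : finFieldType) (F : fieldType) (iota : {rmorphism K -> F}).

Definition vge (v : F -> int) (x : F) (n : int) : Prop := x = 0 \/ n <= v x.

Definition is_place (v : F -> int) : Prop :=
  [/\ v 0 = 0,
      (forall x y, x != 0 -> y != 0 -> v (x * y) = v x + v y),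
      (forall x y, x != 0 -> y != 0 -> x + y != 0 ->
          Num.min (v x) (v y) <= v (x + y)),
      (exists t, t != 0 /\ v t = 1) &
      (forall a, a != 0 -> v (iota a) = 0)].

(* Linear algebra over K inside F, modulo a subset S (S = {0} gives the     *)
(* usual notions).                                                          *)
Definition indep_mod (k : nat) (b : 'I_k -> F) (S : F -> Prop) : Prop :=
  forall c : 'I_k -> K, S (\sum_(i < k) iota (c i) * b i) -> forall i, c i = 0.
Definition span_mod (k : nat) (b : 'I_k -> F) (T S : F -> Prop) : Prop :=
  forall f, T f -> exists c : 'I_k -> K, S (f - \sum_(i < k) iota (c i) * b i).
Definition dim_mod (T S : F -> Prop) (k : nat) : Prop :=
  exists b : 'I_k -> F,
    [/\ forall i, T (b i), indep_mod b S & span_mod b T S].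
Definition is_zero (x : F) : Prop := x = 0.

(* degree of a place: dimension over K of its residue field O_P / P *)
Definition place_deg (v : F -> int) (d : nat) : Prop :=
  dim_mod (fun f => vge v f 0) (fun f => vge v f 1) d.

Definition rational_place (v : F -> int) : Prop := is_place v /\ place_deg v 1.

(* divisors: finitely supported D : places -> int; deg D = d *)
Definition div_deg (D : (F -> int) -> int) (d : int) : Prop :=
  exists s : seq ((F -> int) * nat)%type,
    [/\ List.NoDup (map fst s),
        (forall v, D v != 0 -> List.In v (map fst s)),
        (forall p, List.In p s -> is_place p.1 /\ place_deg p.1 p.2) &
        d = \sum_(p <- s) D p.1 * (p.2)%:Z].

Definition inLD (D : (F -> int) -> int) (f : F) : Prop :=
  forall v, is_place v -> vge v f (- D v).

(* genus (Riemann's definition):  g = max_D (deg D - l(D) + 1) *)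
Definition is_genus (g : nat) : Prop :=
  (forall D d l, div_deg D d -> dim_mod (inLD D) is_zero l ->
      d - l%:Z + 1 <= g%:Z) /\
  (exists D d l, [/\ div_deg D d, dim_mod (inLD D) is_zero l &
      d - l%:Z + 1 = g%:Z]).

(* F / K is an algebraic function field of one variable with full constant *)
(* field K (i.e. comes from an absolutely irreducible curve over K).       *)
Definition function_field : Prop :=
  (exists x : F,
     (forall p : {poly K}, p != 0 -> (map_poly iota p).[x] != 0) /\
     exists (k : nat) (b : 'I_k -> F), forall f, exists p q : 'I_k -> {poly K},
        f = \sum_(i < k) ((map_poly iota (p i)).[x] / (map_poly iota (q i)).[x]) * b i)
  /\ (forall z : F, (exists p : {poly K}, p != 0 /\ root (map_poly iota p) z) ->
        exists a, z = iota a).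

(* K_Q = union of the L(iQ): functions with poles only at Q *)
Definition inKQ (Q : F -> int) (f : F) : Prop :=
  forall v, is_place v -> v <> Q -> vge v f 0.
Definition inLmQ (Q : F -> int) (m : nat) (f : F) : Prop :=
  inKQ Q f /\ vge Q f (- m%:Z).
(* f(P) = a, for a rational place P and f regular at P *)
Definition evalP (v : F -> int) (f : F) (a : K) : Prop := vge v (f - iota a) 1.

Definition encodes (n : nat) (P : 'I_n -> F -> int) (Q : F -> int) (m : nat)
    (f : F) (c : 'I_n -> K) : Prop :=
  inLmQ Q m f /\ forall j, evalP (P j) f (c j).
Definition in_code n P Q m (c : 'I_n -> K) : Prop := exists f, encodes P Q m f c.

Definition wval_le (Q : F -> int) (m : nat) (A : {poly F}) (w : int) : Prop :=
  forall j, A`_j != 0 -> (j * m)%:Z - Q (A`_j) <= w.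

(* A in K_Q[Y] has a zero of multiplicity >= Mu a j at every (P_j, a) *)
Definition interp_ok n (P : 'I_n -> F -> int) (Q : F -> int)
    (Mu : K -> 'I_n -> nat) (A : {poly F}) : Prop :=
  (forall i, inKQ Q (A`_i)) /\
  forall a j i, vge (P j) ((A \Po ('X + (iota a)%:P))`_i) ((Mu a j)%:Z - i%:Z).

Definition is_interpolation n P Q (m : nat) (Mu : K -> 'I_n -> nat)
    (A : {poly F}) : Prop :=
  [/\ A != 0, interp_ok P Q Mu A &
      forall B, B != 0 -> interp_ok P Q Mu B ->
        forall w, wval_le Q m B w -> wval_le Q m A w].

Definition on_list n P Q m (A : {poly F}) (c : 'I_n -> K) : Prop :=
  exists f, encodes P Q m f c /\ ('X - f%:P) %| A.

End FunctionFields.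

Section Reals.
Variables (R : realType) (K : finFieldType) (n : nat).

Definition reliability (Pi : K -> 'I_n -> R) : Prop :=
  (forall a j, 0 <= Pi a j) /\ (forall j, \sum_(a : K) Pi a j = 1).

Definition frob (A B : K -> 'I_n -> R) : R := \sum_(a : K) \sum_(j < n) A a j * B a j.
Definition score (Pi : K -> 'I_n -> R) (c : 'I_n -> K) : R := \sum_(j < n) Pi (c j) j.

Definition cost (Mu : K -> 'I_n -> nat) : R :=
  (\sum_(a : K) \sum_(j < n) ((Mu a j) * (Mu a j).+1)%:R) / 2.

Definition Lm (g m : nat) (Mu : K -> 'I_n -> nat) : R :=
  (g%:R + Num.sqrt (2 * m%:R * (cost Mu + g%:R) + g%:R ^+ 2)) / m%:R.

End Reals.

Section Bound.
Variable R : realType.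
Definition bsq (gt L : R) : R := Num.sqrt (1 - (2 * gt / L) * (1 + 2 / L)).
Definition bnum (gt L : R) : R := 1 + (gt + Num.sqrt (2 * gt)) / (L * bsq gt L).
Definition bden (rt gt q L : R) : R :=
  1 - 1 / (L * bsq gt L) * (Num.sqrt q / (2 * Num.sqrt rt) + 1 / rt).
Definition bfactor (rt gt q L : R) : R := bnum gt L / bden rt gt q L.
End Bound.

(* Main.v *)
Require Import Defs.
From HB Require Import structures.
From mathcomp Require Import all_boot all_order all_algebra.
From mathcomp Require Import finfield.
From mathcomp Require Import boolp reals.
From mathcomp Require Import zify ring lra.
From Stdlib Require List.
Set Implicit Arguments. Unset Strict Implicit. Unset Printing Implicit Defensive.
Import Order.TTheory GRing.Theory Num.Theory.
Local Open Scope ring_scope.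

(* Let W = m L_m(M), so that W^2 - 2 g W = 2 m (C(M) + g).  By Riemann's
   inequality l(tQ) >= t + 1 - g, the polynomials of weighted Q-valuation at
   most the integer part of W outnumber the C(M) linear interpolation
   conditions, so Q_M has weighted valuation at most W.  If f in L(mQ) encodes
   c, then Q_M(f) has at most W poles, all at Q, and at least
   S = sum_j M(c_j, j) zeros; hence Q_M(f) = 0 as soon as S > W.

   For the latter, |lam Pi| >= |M| and Cauchy-Schwarz give
   lam |Pi| > sqrt(2 C(M)) - sqrt(q n) / 2, while S >= lam <Pi, [c]> - n; the
   bound on <Pi, [c]> / |Pi| is what these need, because
   sqrt(2 C(M) / m) = sqrt(l^2 - 2 gt l - 2 gt) for l = L_m(M).

   That a function has no more zeros than poles is derived from the dimension
   bound l(tQ) <= t + 1 and weak approximation. *)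

(** * Places *)

(** The only numerical input on the function field is that [g] is the maximum of deg D - l(D) + 1.
    The bound itself is Riemann's inequality; that it is attained forces a function without poles
    that vanishes at Q to be 0, and this gives l(tQ) <= t + 1. Zeros are then bounded by counting
    dimensions, and two obstacles shape that part. Functions with prescribed orders must be
    controlled at all P_j at once, so a function separating two places is first made regular at
    every rational place. They also have uncontrolled poles away from Q, so they are multiplied into
    K_Q by leading coefficients of algebraic equations over [K[y]], where y is the function whose
    zeros are counted. *)

Lemma linear_system_solution (K : fieldType) (X Y : finType) (e : X -> Y -> K) :
  (#|Y| < #|X|)%N ->
  exists c : X -> K, (exists x, c x != 0) /\
    forall y, \sum_x c x * e x y = 0.
Proof.
move=> ltYX.
pose A := \matrix_(i < #|X|, j < #|Y|) e (enum_val i) (enum_val j).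
have ker_n0 : kermx A != 0.
  rewrite kermx_eq0 /row_free; apply/negP => /eqP rA.
  by have := rank_leq_col A; rewrite rA leqNgt ltYX.
pose r := nz_row (kermx A).
have rn0 : r != 0 by rewrite nz_row_eq0.
have rA : r *m A = 0 by apply/sub_kermxP; exact: nz_row_sub.
exists (fun x => r 0 (enum_rank x)); split.
  have [i ri] : exists i, r 0 i != 0.
    apply/existsP; apply: contraNT rn0 => /existsPn r0.
    by apply/eqP/rowP => i; rewrite mxE; have /negbNE/eqP := r0 i.
  by exists (enum_val i); rewrite enum_valK.
move=> y; have /rowP/(_ (enum_rank y)) := rA; rewrite !mxE => rAy.
apply: etrans rAy; rewrite [RHS](reindex (@enum_rank X)) /=; last first.
  by exists enum_val => i _; rewrite ?enum_rankK ?enum_valK.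
by apply: eq_bigr => x _; rewrite !mxE !enum_rankK.
Qed.

Section Places.
Variables (K : finFieldType) (F : fieldType) (iota : {rmorphism K -> F}).
Implicit Types (v : F -> int) (x y : F).

Lemma placeM v x y : is_place iota v -> x != 0 -> y != 0 -> v (x * y) = v x + v y.
Proof. by case=> _ + _ _ _; apply. Qed.

Lemma place_const v a : is_place iota v -> v (iota a) = 0.
Proof.
by case=> v0 _ _ _ vc; have [->|/vc//] := eqVneq a 0; rewrite rmorph0.
Qed.

Lemma place1 v : is_place iota v -> v 1 = 0.
Proof. by move=> pv; rewrite -(rmorph1 iota) place_const. Qed.

Lemma placeN v x : is_place iota v -> v (- x) = v x.
Proof.
move=> pv; have [->|x0] := eqVneq x 0; first by rewrite oppr0.
rewrite -mulN1r placeM ?oppr_eq0 ?oner_eq0 //.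
by rewrite -[in v (-1)](rmorph1 iota) -rmorphN place_const ?add0r.
Qed.

Lemma placeX v x k : is_place iota v -> v (x ^+ k) = v x *+ k.
Proof.
move=> pv; have [->|x0] := eqVneq x 0.
  case: k => [|k]; first by rewrite expr0 place1.
  by case: pv => v0 *; rewrite exprS mul0r v0 mul0rn.
elim: k => [|k IH]; first by rewrite expr0 place1 // mulr0n.
by rewrite exprS placeM ?expf_neq0 // IH mulrS.
Qed.

Lemma placeV v x : is_place iota v -> v x^-1 = - v x.
Proof.
move=> pv; have [->|x0] := eqVneq x 0.
  by case: pv => v0 *; rewrite invr0 v0 oppr0.
apply/eqP; rewrite -addr_eq0 -placeM ?invr_eq0 // mulVf // place1 //.
Qed.

Lemma vge_le v x (a b : int) : vge v x a -> b <= a -> vge v x b.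
Proof. by case=> [->|h] ba; [left | right; exact: le_trans h]. Qed.

Lemma vge0 v (a : int) : vge v 0 a.
Proof. by left. Qed.

Lemma vge_val v x : vge v x (v x).
Proof. by right. Qed.

Lemma vgeD v x y (a : int) :
  is_place iota v -> vge v x a -> vge v y a -> vge v (x + y) a.
Proof.
case=> _ _ vD _ _ [->|xa]; first by rewrite add0r.
case=> [->|ya]; first by rewrite addr0; right.
have [->|x0] := eqVneq x 0; first by rewrite add0r; right.
have [->|y0] := eqVneq y 0; first by rewrite addr0; right.
have [->|xy0] := eqVneq (x + y) 0; first by left.
by right; apply: le_trans (vD _ _ x0 y0 xy0); rewrite le_min xa.
Qed.

Lemma vgeM v x y (a b : int) :
  is_place iota v -> vge v x a -> vge v y b -> vge v (x * y) (a + b).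
Proof.
move=> pv [->|xa]; first by rewrite mul0r; left.
case=> [->|ya]; first by rewrite mulr0; left.
have [->|x0] := eqVneq x 0; first by rewrite mul0r; left.
have [->|y0] := eqVneq y 0; first by rewrite mulr0; left.
by right; rewrite placeM // lerD.
Qed.

Lemma vge_const v a : is_place iota v -> vge v (iota a) 0.
Proof. by move=> pv; right; rewrite place_const. Qed.

Lemma vge1 v : is_place iota v -> vge v 1 0.
Proof. by move=> pv; rewrite -(rmorph1 iota); apply: vge_const. Qed.

Lemma vgeZ v c x (a : int) :
  is_place iota v -> vge v x a -> vge v (iota c * x) a.
Proof. by move=> pv xa; rewrite -[a]add0r; apply: vgeM => //; apply: vge_const. Qed.

Lemma vgeN v x (a : int) : is_place iota v -> vge v x a -> vge v (- x) a.
Proof. by move=> pv [->|xa]; [rewrite oppr0; left | right; rewrite placeN]. Qed.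

Lemma vgeB v x y (a : int) :
  is_place iota v -> vge v x a -> vge v y a -> vge v (x - y) a.
Proof. by move=> pv xa ya; apply: vgeD => //; apply: vgeN. Qed.

Lemma vge_sum v (I : Type) (s : seq I) (P : pred I) (G : I -> F) (a : int) :
  is_place iota v -> (forall i, P i -> vge v (G i) a) ->
  vge v (\sum_(i <- s | P i) G i) a.
Proof.
by move=> pv h; apply: (big_ind (fun x => vge v x a)) => //;
  [left | move=> x y; apply: vgeD].
Qed.

Lemma vgeX v x (a : int) k :
  is_place iota v -> vge v x a -> vge v (x ^+ k) (a *+ k).
Proof.
move=> pv xa; elim: k => [|k IH]; first by rewrite expr0 mulr0n; apply: vge1.
by rewrite exprS mulrS; apply: vgeM.
Qed.

Lemma vge_prod0 v (I : Type) (s : seq I) (P : pred I) (G : I -> F) :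
  is_place iota v -> (forall i, P i -> vge v (G i) 0) ->
  vge v (\prod_(i <- s | P i) G i) 0.
Proof.
move=> pv h; apply: (big_ind (fun x => vge v x 0)) => //; first exact: vge1.
by move=> x y hx hy; rewrite -[0%R]addr0; apply: vgeM.
Qed.

Lemma vge_neq0 v x (a : int) : x != 0 -> vge v x a -> a <= v x.
Proof. by move=> x0 [e|//]; rewrite e eqxx in x0. Qed.

Lemma placeD_lt v x y : is_place iota v -> x != 0 -> vge v y (v x + 1) ->
  v (x + y) = v x /\ x + y != 0.
Proof.
move=> pv x0 yx; have xy0 : x + y != 0.
  apply/eqP => /eqP; rewrite addr_eq0 => /eqP xy.
  move: yx => [y0|]; first by rewrite xy y0 oppr0 eqxx in x0.
  by rewrite {1}xy placeN //; lia.
split=> //; apply/le_anti/andP; split.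
  have [->|y0] := eqVneq y 0; first by rewrite addr0.
  rewrite leNgt; apply/negP => lt_xy.
  suff : v x + 1 <= v x by rewrite gerDl.
  apply: vge_neq0 => //; rewrite -[x in vge v x _](addrK y); apply: vgeB => //.
  by right; rewrite lezD1.
have : vge v (x + y) (v x) by apply: vgeD => //; [right | apply: vge_le yx _; lia].
by apply: vge_neq0.
Qed.

Lemma place_prod v (I : Type) (s : seq I) (P : pred I) (G : I -> F) :
  is_place iota v -> (forall i, P i -> G i != 0) ->
  v (\prod_(i <- s | P i) G i) = \sum_(i <- s | P i) v (G i).
Proof.
move=> pv h.
suff [] : v (\prod_(i <- s | P i) G i) = \sum_(i <- s | P i) v (G i) /\
  \prod_(i <- s | P i) G i != 0 by [].
apply: (big_ind2 (fun x a => v x = a /\ x != 0)).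
- by rewrite place1 ?oner_eq0.
- by move=> x a y b [<- x0] [<- y0]; rewrite placeM // mulf_neq0.
- by move=> i Pi; split=> //; exact: h.
Qed.

Lemma rational_residue v x : rational_place iota v -> vge v x 0 ->
  exists a, vge v (x - iota a) 1.
Proof.
move=> [pv [b [b0 _ sp]]] x0.
have [c hc] := sp _ x0; have [d hd] := sp _ (vge1 pv).
move: hc hd; rewrite !big_ord1 => hc hd.
have d0 : d ord0 != 0.
  apply/eqP => d0; move: hd; rewrite d0 rmorph0 mul0r subr0.
  by move/(vge_neq0 (oner_neq0 _)); rewrite place1.
exists (c ord0 / d ord0).
have -> : x - iota (c ord0 / d ord0) =
  (x - iota (c ord0) * b ord0) - iota (c ord0 / d ord0) * (1 - iota (d ord0) * b ord0).
  by rewrite mulrBr mulr1 mulrA -rmorphM divfK //; ring.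
by apply: vgeB => //; apply: vgeZ.
Qed.

(** Degree one puts every residue in [K], so an expansion in powers of the uniformizer [t] can be
    peeled off one coefficient at a time. *)
Lemma rational_jet v t x r : rational_place iota v -> v t = 1 -> t != 0 ->
  vge v x 0 ->
  exists e : 'I_r -> K, vge v (x - \sum_(l < r) iota (e l) * t ^+ l) r%:Z.
Proof.
move=> rv vt t0 x0; have pv := proj1 rv; elim: r => [|r [e he]].
  by exists (fun=> 0); rewrite big_ord0 subr0.
set y := x - _ in he.
have : vge v (y / t ^+ r) 0.
  have -> : 0 = r%:Z + v (t ^+ r)^-1 by rewrite placeV // placeX // vt; lia.
  by apply: vgeM => //; exact: vge_val.
move=> /(rational_residue rv) [a ha].
exists (fun l => if unlift ord_max l is Some l' then e l' else a).
rewrite big_ord_recr /= unlift_none.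
have -> : \sum_(i < r) iota (if unlift ord_max (widen_ord (leqnSn r) i) is Some l
    then e l else a) * t ^+ i = \sum_(i < r) iota (e i) * t ^+ i.
  apply: eq_bigr => i _.
  have -> : widen_ord (leqnSn r) i = lift ord_max i.
    by apply: val_inj; rewrite /= /bump leqNgt ltn_ord.
  by rewrite liftK.
rewrite opprD addrA -/y.
have -> : y - iota a * t ^+ r = (y / t ^+ r - iota a) * t ^+ r.
  by rewrite mulrBl divfK ?expf_neq0.
have -> : r.+1%:Z = 1 + v (t ^+ r) by rewrite placeX // vt; lia.
by apply: vgeM => //; exact: vge_val.
Qed.

Lemma place_uniformizer v : is_place iota v -> exists t, t != 0 /\ v t = 1.
Proof. by case. Qed.

(** Vanishing to order [r] at a rational place costs [r] linear conditions on the coefficients of a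
    combination. Both the upper bound on l(tQ) and the interpolation count rest on this. *)
Lemma jet_conditions v (X : finType) (x : X -> F) (r : nat) :
  rational_place iota v -> (forall i, vge v (x i) 0) ->
  exists e : X -> 'I_r -> K, forall c : X -> K,
    (forall l, \sum_i c i * e i l = 0) -> vge v (\sum_i iota (c i) * x i) r%:Z.
Proof.
move=> rv x0; have pv := proj1 rv; have [t [t0 vt]] := place_uniformizer pv.
have /choice[e he] : forall i, exists e : 'I_r -> K,
    vge v (x i - \sum_(l < r) iota (e l) * t ^+ l) r%:Z.
  by move=> i; apply: rational_jet.
exists e => c hc.
have -> : \sum_i iota (c i) * x i =
  \sum_i iota (c i) * (x i - \sum_(l < r) iota (e i l) * t ^+ l).
  rewrite -[LHS]subr0; under [RHS]eq_bigr do rewrite mulrBr.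
  rewrite big_split /= sumrN; congr (_ - _); apply/esym.
  under eq_bigr do rewrite mulr_sumr.
  rewrite exchange_big /= big1 // => l _.
  under eq_bigr do rewrite mulrA -rmorphM.
  by rewrite -mulr_suml -rmorph_sum hc rmorph0 mul0r.
by apply: vge_sum => // i _; apply: vgeZ.
Qed.

End Places.

(** * Dimension and genus *)

Section Dimension.
Variables (K : finFieldType) (F : fieldType) (iota : {rmorphism K -> F}).

Definition dependent (X : finType) (x : X -> F) : Prop :=
  exists c : X -> K, (exists i, c i != 0) /\ \sum_i iota (c i) * x i = 0.

(** [is_genus] speaks only of spaces that have a basis. Without one, every independent family
    extends, up to length [B.+1]. *)
Lemma dim_mod_exists (T : F -> Prop) (B : nat) :
  (forall x : 'I_B.+1 -> F, (forall i, T (x i)) -> dependent x) ->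
  exists k, dim_mod iota T (@is_zero F) k.
Proof.
move=> bounded; apply: contrapT => nodim.
have [b [bT bi]] : exists b : 'I_B.+1 -> F,
    (forall i, T (b i)) /\ indep_mod iota b (@is_zero F).
  elim: B.+1 => [|k [b [bT bi]]].
    by exists (fun=> 0); split=> [[]//|c _ []].
  have [f [fT fb]] : exists f, T f /\
      ~ exists c : 'I_k -> K, f - \sum_(i < k) iota (c i) * b i = 0.
    apply: contrapT => h; apply: nodim; exists k, b; split=> // f fT.
    by apply: contrapT => h'; apply: h; exists f; split.
  exists (fun i => if unlift ord_max i is Some j then b j else f); split.
    by move=> i; case: unliftP.
  move=> c; rewrite /is_zero big_ord_recr /= unlift_none.
  have wl (i : 'I_k) : widen_ord (leqnSn k) i = lift ord_max i.
    by apply: val_inj; rewrite /= /bump leqNgt ltn_ord.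
  under eq_bigr do rewrite wl liftK.
  move=> sum0; have cmax : c ord_max = 0.
    apply: contrapT => /eqP cn0; apply: fb.
    exists (fun i => - c (lift ord_max i) / c ord_max).
    apply: (mulfI (x := iota (c ord_max))); first by rewrite fmorph_eq0.
    rewrite mulr0 mulrBr -[RHS]sum0 addrC; congr (_ + _).
    rewrite mulr_sumr -sumrN; apply: eq_bigr => i _.
    by rewrite mulrA -rmorphM mulrCA mulfV // mulr1 rmorphN mulNr opprK.
  move: sum0; rewrite cmax rmorph0 mul0r addr0 => /bi c0 i.
  by case: (unliftP ord_max i) => [j ->|->].
have [c [[i ci] sum0]] := bounded b bT.
by rewrite (bi c sum0 i) eqxx in ci.
Qed.

Lemma dim_mod_dependent (T : F -> Prop) (l : nat) (X : finType) (x : X -> F) :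
  dim_mod iota T (@is_zero F) l -> (l < #|X|)%N -> (forall i, T (x i)) ->
  dependent x.
Proof.
move=> [b [bT bi bs]] ltl xT.
have /choice[e he] : forall i, exists c : 'I_l -> K,
    is_zero (x i - \sum_(k < l) iota (c k) * b k) by move=> i; exact: bs.
have [|c [c0 ce]] := @linear_system_solution K X 'I_l e; first by rewrite card_ord.
exists c; split=> //.
under eq_bigr => i _ do rewrite (subr0_eq (he i)) mulr_sumr.
rewrite exchange_big big1 //= => k _.
under eq_bigr do rewrite mulrA -rmorphM.
by rewrite -mulr_suml -rmorph_sum ce rmorph0 mul0r.
Qed.

(** The list in [div_deg] may record any [d] with [place_deg v d]; this makes a rational point count
    with degree one in every such list. *)
Lemma place_deg_rational v (d : nat) :
  rational_place iota v -> place_deg iota v d -> d = 1%N.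
Proof.
move=> rv [b [b0 bi bs]]; have pv := proj1 rv.
have /choice[a ha] : forall i, exists a, vge v (b i - iota a) 1.
  by move=> i; apply: rational_residue => //; apply: b0.
case: d b b0 bi bs a ha => [|[//|d]] b b0 bi bs a ha.
  have [c] := bs _ (vge1 pv).
  by rewrite big_ord0 subr0 => /(vge_neq0 (oner_neq0 _)); rewrite (place1 pv).
have [|c [[i ci] ce]] := @linear_system_solution K _ 'I_1 (fun i _ => a i : K).
  by rewrite !card_ord.
suff /bi c0 : vge v (\sum_(i < d.+2) iota (c i) * b i) 1.
  by rewrite c0 eqxx in ci.
have -> : \sum_(i < d.+2) iota (c i) * b i =
    \sum_(i < d.+2) iota (c i) * (b i - iota (a i)).
  under [RHS]eq_bigr do rewrite mulrBr -rmorphM.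
  by rewrite big_split /= sumrN -rmorph_sum (ce ord0) rmorph0 subr0.
by apply: (vge_sum _ pv) => j _; apply: (vgeZ _ pv).
Qed.

Lemma sum_degree_at (s : seq ((F -> int) * nat)) Q :
  List.NoDup (map fst s) ->
  (forall p, List.In p s -> p.1 = Q -> p.2 = 1%N) ->
  \sum_(p <- s) (if `[< p.1 = Q >] then 1 else 0) * (p.2)%:Z =
    (if `[< List.In Q (map fst s) >] then 1 else 0 : int).
Proof.
elim: s => [|p s IH] /=.
  by rewrite big_nil => _ _; case: asboolP.
move=> nd h; inversion nd as [|x l ps nds]; subst.
rewrite big_cons IH //; last by move=> r rs; apply: h; right.
case: asboolP => [pQ|pQ].
  rewrite (h p) //; last by left.
  case: asboolP => [inQ|_]; first by rewrite -pQ in inQ.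
  by rewrite asboolT //; left.
rewrite mul0r add0r; congr (if _ then _ else _); apply/asboolP/asboolP.
  by right.
by case.
Qed.

Lemma div_deg_add_point D d Q (t : int) :
  div_deg iota D d -> rational_place iota Q ->
  div_deg iota (fun v => D v + (if `[< v = Q >] then t else 0)) (d + t).
Proof.
move=> [s [nd sup pl ->]] rQ.
have one p : List.In p s -> p.1 = Q -> p.2 = 1%N.
  by move=> /pl [_]; case: p => v k /= dk vQ; move: dk; rewrite vQ;
    exact: place_deg_rational.
have eqt (p : (F -> int) * nat) :
    (D p.1 + (if `[< p.1 = Q >] then t else 0)) * p.2%:Z =
    D p.1 * p.2%:Z + t * ((if `[< p.1 = Q >] then 1 else 0) * p.2%:Z).
  by case: ifP => _; ring.
have [inQ|ninQ] := pselect (List.In Q (map fst s)).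
  exists s; split=> //.
    move=> v; case: asboolP => [-> //|_]; rewrite addr0; exact: sup.
  under [RHS]eq_bigr do rewrite eqt.
  by rewrite big_split /= -mulr_sumr sum_degree_at // asboolT // mulr1.
exists ((Q, 1%N) :: s); split=> /=.
- exact: List.NoDup_cons.
- move=> v; case: asboolP => [-> _|_]; first by left.
  by rewrite addr0 => /sup; right.
- by case: rQ => pQ dQ p [<- //|/pl].
rewrite big_cons /= asboolT //.
under [in RHS]eq_bigr do rewrite eqt.
rewrite big_split /= -mulr_sumr sum_degree_at // asboolF // mulr0 addr0.
by have [->|/sup //] := eqVneq (D Q) 0; rewrite add0r mulr1 addrC.
Qed.

Lemma dim_mod_trivial (T : F -> Prop) :
  (forall x, T x -> x = 0) -> dim_mod iota T (@is_zero F) 0.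
Proof.
move=> T0; exists (fun=> 0); split=> [[]//|c _ []//|f /T0 ->].
by exists (fun=> 0); rewrite big_ord0 subr0.
Qed.

(** The factor [h] is there because the powers of [u] are controlled only after multiplication by an
    element of some L(D). *)
Lemma algebraic_powers (X : finType) (h u : F) (e : X -> nat) :
  injective e -> h != 0 -> dependent (fun i => h * u ^+ (e i)) ->
  exists p : {poly K}, p != 0 /\ root (map_poly iota p) u.
Proof.
move=> einj h0 [c [[i ci] sum0]].
exists (\sum_i (c i) *: 'X^(e i)); split.
  apply/eqP => /(congr1 (fun p : {poly K} => p`_(e i))); rewrite coef0 coef_sum.
  rewrite (bigD1 i) //= coefZ coefXn eqxx mulr1 big1 ?addr0; last first.
    move=> j ji; rewrite coefZ coefXn; case: eqP => [/einj ij|_]; last exact: mulr0.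
    by rewrite ij eqxx in ji.
  by move/eqP; rewrite (negPf ci).
rewrite /root rmorph_sum horner_sum; apply/eqP/(mulfI h0); rewrite mulr0 -[RHS]sum0.
rewrite mulr_sumr; apply: eq_bigr => j _.
by rewrite /= map_polyZ map_polyXn hornerZ hornerXn mulrCA.
Qed.

Section Genus.
Variables (g : nat) (Q : F -> int).
Hypotheses (ff : function_field iota) (hg : is_genus iota g)
           (rQ : rational_place iota Q).

(** Take [D] attaining the genus. If L(D) contains some [h != 0], all [h * u ^+ k] lie in that
    finite-dimensional space, so [u] is algebraic, hence constant, and a constant vanishing at [Q]
    is 0. If L(D) = 0, maximality gives a nonzero [h] in L(D + Q); then [h * u] lies in L(D), so
    [u = 0]. *)
Lemma regular_vanishing_eq0 u :
  (forall v, is_place iota v -> vge v u 0) -> vge Q u 1 -> u = 0.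
Proof.
move=> ureg uQ; have [pQ _] := rQ.
have mulL D h : inLD iota D h -> inLD iota D (h * u).
  by move=> hD v pv; rewrite -[- D v]addr0; apply: (vgeM pv); [exact: (hD v pv)|exact: (ureg v pv)].
case: hg => riem [D [d [l [dD dl dg]]]].
have [[h [hD h0]]|noh] := pselect (exists h, inLD iota D h /\ h != 0).
  have mulLX k : inLD iota D (h * u ^+ k).
    elim: k => [|k IH]; first by rewrite mulr1.
    by rewrite exprSr mulrA; apply: mulL.
  have : dependent (fun k : 'I_l.+1 => h * u ^+ k).
    by apply: (dim_mod_dependent dl) => [|k]; [rewrite card_ord | exact: mulLX].
  move=> /(algebraic_powers (@ord_inj _) h0) /(proj2 ff) [a ua].
  move: uQ; rewrite ua => -[//|]; by rewrite (place_const _ pQ).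
have L0 x : inLD iota D x -> x = 0.
  by move=> xD; apply: contrapT => /eqP x0; apply: noh; exists x.
have l0 : l = 0%N.
  case: l dl {dg} => [//|l] [b [bD bi _]].
  have b0 := L0 _ (bD ord0).
  suff /(_ ord0) : forall i : 'I_l.+1, (i == ord0)%:R = 0 :> K.
    by rewrite eqxx => /eqP; rewrite oner_eq0.
  apply: bi; rewrite /is_zero big1 // => i _.
  by rewrite (L0 _ (bD i)) mulr0.
pose D' v := D v + (if `[< v = Q >] then 1 else 0).
have [h [hD' h0]] : exists h, inLD iota D' h /\ h != 0.
  apply: contrapT => noh'.
  have /dim_mod_trivial dl' : forall x, inLD iota D' x -> x = 0.
    by move=> x xD; apply: contrapT => /eqP x0; apply: noh'; exists x.
  have := riem _ _ _ (div_deg_add_point 1 dD rQ) dl'.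
  by rewrite -dg l0 subr0; lia.
suff /L0/eqP : inLD iota D (h * u) by rewrite mulf_eq0 (negPf h0) => /eqP.
move=> v pv; have := hD' v pv; rewrite /D'; case: asboolP => [-> hv|_ hv].
  have -> : - D Q = - (D Q + 1) + 1 by lia.
  exact: (vgeM pQ).
by rewrite -[- D v]addr0; apply: (vgeM pv); [rewrite addr0 in hv|exact: ureg].
Qed.

Lemma regular_const u : (forall v, is_place iota v -> vge v u 0) ->
  exists a, u = iota a.
Proof.
move=> ureg; have [pQ _] := rQ.
have [a ha] := rational_residue rQ (ureg _ pQ).
exists a; apply/subr0_eq/regular_vanishing_eq0 => // v pv.
by apply: (vgeB pv); [exact: ureg | exact: (vge_const _ pv)].
Qed.

Lemma inLmQ_place t v x : inLmQ iota Q t x -> is_place iota v ->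
  vge v x (- (if `[< v = Q >] then t%:Z else 0)).
Proof.
move=> [xK xQ] pv; case: asboolP => [-> //|vQ]; rewrite oppr0.
exact: xK.
Qed.

(** Multiplying by [pi ^+ t] clears the pole at [Q]; killing the first [t + 1] jet coefficients
    leaves a combination without poles that vanishes at [Q], hence 0. *)
Lemma LmQ_dependent (t : nat) (X : finType) (x : X -> F) :
  (t.+1 < #|X|)%N -> (forall i, inLmQ iota Q t (x i)) -> dependent x.
Proof.
move=> ltX xL; have [pQ _] := rQ; have [pi [pi0 pi1]] := place_uniformizer pQ.
have Qpit : Q (pi ^+ t) = t by rewrite (placeX _ _ pQ) pi1; lia.
have [e he] : exists e : X -> 'I_t.+1 -> K, forall c : X -> K,
    (forall l, \sum_i c i * e i l = 0) ->
    vge Q (\sum_i iota (c i) * (x i * pi ^+ t)) t.+1%:Z.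
  apply: jet_conditions => // i; have [_ xQ] := xL i.
  have -> : 0 = - t%:Z + Q (pi ^+ t) by rewrite Qpit addNr.
  by apply: (vgeM pQ) => //; exact: vge_val.
have [|c [c0 ce]] := @linear_system_solution K X 'I_t.+1 e; first by rewrite card_ord.
exists c; split=> //.
have := he c ce; under eq_bigr do rewrite mulrA; rewrite -mulr_suml => sQ.
have s1 : vge Q (\sum_i iota (c i) * x i) 1.
  rewrite -[\sum_i _](mulfK (expf_neq0 t pi0)).
  have -> : 1 = t.+1%:Z + Q (pi ^+ t)^-1 by rewrite (placeV _ pQ) Qpit; lia.
  by apply: (vgeM pQ) => //; exact: vge_val.
apply: regular_vanishing_eq0 => // v pv.
have [->|vQ] := pselect (v = Q); first exact: vge_le s1 _.
by apply: (vge_sum _ pv) => i _; apply: (vgeZ _ pv); case: (xL i) => + _; apply.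
Qed.

Lemma riemann_LmQ (t : nat) :
  exists l, t%:Z - l%:Z + 1 <= g%:Z /\ dim_mod iota (inLmQ iota Q t) (@is_zero F) l.
Proof.
have [l dl] : exists l, dim_mod iota (inLmQ iota Q t) (@is_zero F) l.
  apply: (@dim_mod_exists _ t.+1) => x xT.
  by apply: (@LmQ_dependent t) => //; rewrite card_ord.
exists l; split=> //.
pose D v := 0 + (if `[< v = Q >] then t%:Z else 0 : int).
have dD : div_deg iota D (0 + t).
  apply: (@div_deg_add_point (fun=> 0) 0 Q t%:Z _ rQ); exists [::]; split=> //=.
  - exact: List.NoDup_nil.
  - by rewrite big_nil.
rewrite -[t%:Z]add0r; case: hg => riem _; apply: riem dD _.
case: dl => b [bT bi bs]; exists b; split=> //.
  by move=> i v pv; rewrite /D add0r; exact: inLmQ_place.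
move=> f fD; apply: bs; split.
  by move=> v pv vQ; have := fD v pv; rewrite /D asboolF // addr0 oppr0.
have [pQ _] := rQ.
by have := fD Q pQ; rewrite /D asboolT // add0r.
Qed.

End Genus.
End Dimension.

(** * Denominators in the ring of functions with poles only at Q *)

Section Algebraic.
Variables (K : finFieldType) (F : fieldType) (iota : {rmorphism K -> F}).

Section Generators.
Variables (x : F) (k : nat) (b : 'I_k -> F).
Local Notation ev p := (map_poly iota p).[x].

(** For fixed [s] this is the [K]-span of the [k * s.+1] products [x ^+ a * b i] with [a <= s], the
    space in which algebraic dependence is counted. *)
Definition poly_comb (s : nat) (y : F) : Prop :=
  exists p : 'I_k -> {poly K},
    (forall i, size (p i) <= s.+1)%N /\ y = \sum_(i < k) ev (p i) * b i.

Lemma poly_comb0 s : poly_comb s 0.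
Proof.
exists (fun=> 0); split=> [i|]; first by rewrite size_poly0.
by rewrite big1 // => i _; rewrite rmorph0 horner0 mul0r.
Qed.

Lemma poly_combD s y z : poly_comb s y -> poly_comb s z -> poly_comb s (y + z).
Proof.
move=> [p [sp ->]] [r [sr ->]]; exists (fun i => p i + r i); split=> [i|].
  by apply: leq_trans (size_polyD _ _) _; rewrite geq_max sp sr.
by rewrite -big_split; apply: eq_bigr => i _; rewrite rmorphD hornerD mulrDl.
Qed.

Lemma poly_comb_mul s s' (r : {poly K}) y :
  (size r <= s'.+1)%N -> poly_comb s y -> poly_comb (s + s') (ev r * y).
Proof.
move=> sr [p [sp ->]]; exists (fun i => r * p i); split=> [i|].
  by apply: leq_trans (size_polyMleq _ _) _; have := sp i; lia.
by rewrite mulr_sumr; apply: eq_bigr => i _; rewrite rmorphM hornerM mulrA.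
Qed.

Lemma poly_comb_linear s e (h : F) y :
  (forall i, poly_comb e (h * b i)) -> poly_comb s y -> poly_comb (s + e) (h * y).
Proof.
move=> hb [p [sp ->]]; rewrite mulr_sumr.
apply: (big_ind (poly_comb (s + e))).
- exact: poly_comb0.
- exact: poly_combD.
by move=> i _; rewrite mulrCA addnC; apply: poly_comb_mul.
Qed.

Lemma poly_comb_le s s' y : (s <= s')%N -> poly_comb s y -> poly_comb s' y.
Proof.
move=> le [p [sp ->]]; exists p; split=> // i; exact: leq_trans (sp i) _.
Qed.

Hypothesis trans : forall p : {poly K}, p != 0 -> ev p != 0.
Hypothesis gen : forall f, exists p q : 'I_k -> {poly K},
  f = \sum_(i < k) (ev (p i) / ev (q i) * b i).

Lemma clear_denominator y : exists d : {poly K}, d != 0 /\ exists s, poly_comb s (ev d * y).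
Proof.
have [p [q ->]] := gen y.
(* [gen] may supply a zero denominator. Its term is then 0, since the inverse of 0 is 0, so the
   denominator is replaced by 1 and, in [r] below, the numerator by 0. *)
pose d i := if q i == 0 then 1 else q i.
have d0 i : d i != 0 by rewrite /d; case: ifPn => // _; exact: oner_neq0.
exists (\prod_i d i); split; first by apply/prodf_neq0 => i _; exact: d0.
pose r i := if q i == 0 then 0 else p i * \prod_(j | j != i) d j.
exists (\max_i size (r i)); exists r; split.
  by move=> i; apply: leqW; exact: (leq_bigmax i).
rewrite mulr_sumr; apply: eq_bigr => i _; rewrite mulrA; congr (_ * _).
rewrite (bigD1 i) //= rmorphM hornerM /r /d.
case: ifPn => [/eqP ->|qi0]; first by rewrite rmorph0 horner0 invr0 !mulr0.
rewrite [in RHS]rmorphM hornerM.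
have : ev (q i) != 0 by exact: trans.
by move=> e0; field.
Qed.

Lemma clear_denominators (Y : finType) (y : Y -> F) :
  exists d : {poly K}, d != 0 /\ exists s, (size d <= s.+1)%N /\ forall i, poly_comb s (ev d * y i).
Proof.
have /choice[d hd] := fun i => clear_denominator (y i).
have /choice[s hs] := fun i => proj2 (hd i).
pose D := \prod_i d i; pose c i := \prod_(j | j != i) d j.
exists D; split; first by apply/prodf_neq0 => i _; exact: (proj1 (hd i)).
exists (size D + \max_i (s i + size (c i)))%N; split; first by lia.
move=> i; have -> : ev D * y i = ev (c i) * (ev (d i) * y i).
  by rewrite /D (bigD1 i) //= rmorphM hornerM mulrA [ev (d i) * _]mulrC.
apply: (@poly_comb_le (s i + size (c i))).
  by apply: leq_trans (leq_addl _ _); exact: (leq_bigmax i).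
by apply: poly_comb_mul.
Qed.

(* Clearing denominators, the [(T + 1) ^ 2] monomials [f ^ i * u ^ j] with
   [i, j <= T] lie in a space of dimension [O(T)]. *)
Lemma algebraic_dependence (f u : F) :
  exists (T : nat) (c : 'I_T * 'I_T -> K), (exists ij, c ij != 0) /\
    \sum_ij iota (c ij) * (f ^+ ij.1 * u ^+ ij.2) = 0.
Proof.
pose y (z : unit + ('I_k + 'I_k)) :=
  match z with inl _ => 1 | inr (inl i) => f * b i | inr (inr i) => u * b i end.
have [d [d0 [e [sd hd]]]] := clear_denominators y.
(* This choice gives [k * s.+1 <= T ^ 2 + T], less than the [T.+1 ^ 2] monomials. *)
pose T := (2 * (k * e.+1))%N; pose s := (e * (2 * T).+1)%N.
have pf i a : poly_comb a i -> poly_comb (a + e) (ev d * f * i).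
  by apply: poly_comb_linear => j; rewrite -mulrA; exact: (hd (inr (inl j))).
have pu i a : poly_comb a i -> poly_comb (a + e) (ev d * u * i).
  by apply: poly_comb_linear => j; rewrite -mulrA; exact: (hd (inr (inr j))).
have base i j l : poly_comb (e * (i + j + l).+1)
    (ev d ^+ l * ((ev d * f) ^+ i * ((ev d * u) ^+ j * ev d))).
  elim: l => [|l IH]; last first.
    rewrite addnS mulnS addnC exprS -mulrA.
    by apply: poly_comb_mul.
  rewrite mul1r addn0; elim: i => [|i IH]; last first.
    by rewrite addSn mulnS addnC exprS -mulrA; apply: pf.
  rewrite mul1r add0n; elim: j => [|j IH]; last first.
    by rewrite mulnS addnC exprS -mulrA; apply: pu.
  by rewrite muln1 mul1r -[ev d]mulr1; exact: (hd (inl tt)).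
(* Each occurrence of [f] or [u] uses one factor [ev d], and writing 1 as a combination uses one
   more; the rest is padding that gives all monomials the same multiplier. *)
pose E := ev d ^+ (2 * T).+1.
have /choice[p hp] : forall ij : 'I_T.+1 * 'I_T.+1, exists p : 'I_k -> {poly K},
    (forall a, size (p a) <= s.+1)%N /\
    E * (f ^+ ij.1 * u ^+ ij.2) = \sum_(a < k) ev (p a) * b a.
  move=> [i j] /=; have := base i j (2 * T - (i + j))%N.
  have ltij : (i + j <= 2 * T)%N by have := ltn_ord i; have := ltn_ord j; lia.
  rewrite subnKC //; congr (poly_comb _ _).
  have -> : E = ev d ^+ (2 * T - (i + j)) * (ev d ^+ i * ev d ^+ j * ev d).
    by rewrite -exprD -exprSr -exprD /E; congr (_ ^+ _); lia.
  by rewrite !exprMn; ring.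
have [|c [c0 hc]] := @linear_system_solution K ('I_T.+1 * 'I_T.+1)%type
    ('I_k * 'I_s.+1)%type (fun ij ab => (p ij ab.1)`_ab.2).
  by rewrite !card_prod !card_ord /s /T; nia.
exists T.+1, c; split=> //.
have E0 : E != 0 by rewrite expf_neq0 // trans.
apply: (mulfI E0); rewrite mulr0 mulr_sumr.
under eq_bigr => ij _ do rewrite mulrCA (proj2 (hp ij)) mulr_sumr.
rewrite exchange_big /= big1 // => a _.
under eq_bigr do rewrite mulrA.
rewrite -mulr_suml.
have -> : \sum_ij iota (c ij) * ev (p ij a) = ev (\sum_ij c ij *: p ij a).
  rewrite rmorph_sum horner_sum; apply: eq_bigr => ij _.
  by rewrite /= map_polyZ hornerZ.
have -> : \sum_ij c ij *: p ij a = 0; last by rewrite rmorph0 horner0 mul0r.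
apply/polyP => m; rewrite coef0 coef_sum.
under eq_bigr do rewrite coefZ.
have [ms|ms] := ltnP m s.+1; first exact: (hc (a, Ordinal ms)).
rewrite big1 // => ij _; rewrite nth_default ?mulr0 //.
by apply: leq_trans ms; case: (hp ij).
Qed.

End Generators.

(** The product is integral over the coefficients of [G]: if it had a pole at [v], so would [z], and
    the leading term of the equation would have strictly smaller value than all the others. *)
Lemma pole_denominator v (G : {poly F}) z : is_place iota v ->
  (forall i, vge v G`_i 0) -> G != 0 -> root G z -> vge v (lead_coef G * z) 0.
Proof.
move=> pv Greg G0 /eqP; rewrite horner_coef.
have [d sG] : exists d, size G = d.+1.
  by exists (size G).-1; rewrite prednK // lt0n size_poly_eq0.
rewrite lead_coefE sG /= big_ord_recr /=.
have gd0 : G`_d != 0 by have := G0; rewrite -lead_coef_eq0 lead_coefE sG.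
move=> sum0; have [->|z0] := eqVneq z 0; first by rewrite mulr0; left.
right; rewrite (placeM pv) // leNgt; apply/negP => neg.
have gpos := vge_neq0 gd0 (Greg d).
have d_gt0 : (0 < d)%N.
  case: d sum0 sG {neg gpos} gd0 => [|//] + _ gd0.
  by rewrite big_ord0 add0r expr0 mulr1 => g0; rewrite g0 eqxx in gd0.
have : vge v (G`_d * z ^+ d) (v z *+ d.-1).
  have -> : G`_d * z ^+ d = - \sum_(i < d) G`_i * z ^+ i.
    by apply/eqP; rewrite -addr_eq0 addrC sum0.
  apply: (vgeN pv); apply: (vge_sum _ pv) => i _.
  rewrite -[_ *+ _]add0r; apply: (vgeM pv) => //.
  right; rewrite (placeX _ _ pv); apply: ler_wnMn2l; first by lra.
  by have := ltn_ord i; lia.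
move/(vge_neq0 (mulf_neq0 gd0 (expf_neq0 d z0))).
rewrite (placeM pv) ?expf_neq0 // (placeX _ _ pv).
have -> : v z *+ d = v z + v z *+ d.-1 by rewrite -mulrS prednK.
by lra.
Qed.

(** The pole at [Q] makes [y] nonconstant, hence transcendental, and [z] satisfies a nontrivial
    equation over [K[y]], whose elements lie in K_Q. Its leading coefficient serves as [h]. *)
Lemma inKQ_common_denominator Q y z : function_field iota -> is_place iota Q ->
  inKQ iota Q y -> Q y < 0 -> exists h, [/\ h != 0, inKQ iota Q h & inKQ iota Q (h * z)].
Proof.
move=> [[x [xt [k [b gen]]]] algc] pQ yK yQ.
have yt (p : {poly K}) : p != 0 -> (map_poly iota p).[y] != 0.
  move=> p0; apply/eqP => py; have [|a ya] := algc y.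
    by exists p; split=> //; apply/eqP.
  by move: yQ; rewrite ya (place_const _ pQ).
have [T [c [[[i0 j0] c0] sum0]]] := algebraic_dependence xt gen y z.
pose q (j : 'I_T) := \sum_(i < T) c (i, j) *: 'X^i.
pose G := \sum_(j < T) (map_poly iota (q j)).[y] *: 'X^j.
have Gc m : G`_m = if insub m is Some j then (map_poly iota (q j)).[y] else 0.
  rewrite coef_sum; case: insubP => [j _ jm|mT].
    rewrite (bigD1 j) //= coefZ coefXn jm eqxx mulr1 big1 ?addr0 // => l lj.
    rewrite coefZ coefXn -jm; case: eqP => [/ord_inj jl|_]; last exact: mulr0.
    by rewrite jl eqxx in lj.
  rewrite big1 // => l _; rewrite coefZ coefXn; case: eqP => [ml|_]; last exact: mulr0.
  by move: mT; rewrite ml ltn_ord.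
have qy j : (map_poly iota (q j)).[y] = \sum_(i < T) iota (c (i, j)) * y ^+ i.
  rewrite rmorph_sum horner_sum; apply: eq_bigr => i _.
  by rewrite /= map_polyZ map_polyXn hornerZ hornerXn.
have G0 : G != 0.
  apply/eqP => G0; have := Gc j0; rewrite G0 coef0 valK => /esym/eqP.
  apply/negP/yt/eqP => /(congr1 (fun p : {poly K} => p`_i0)).
  rewrite coef0 coef_sum (bigD1 i0) //= coefZ coefXn eqxx mulr1 big1 ?addr0.
    by apply/eqP.
  move=> i ii; rewrite coefZ coefXn; case: eqP => [/ord_inj e|_]; last exact: mulr0.
  by rewrite e eqxx in ii.
have Gz : root G z.
  rewrite /root horner_sum -[X in _ == X]sum0; apply/eqP.
  rewrite (eq_bigr (fun ij => iota (c (ij.1, ij.2)) * (y ^+ ij.1 * z ^+ ij.2)));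
    last by move=> [].
  rewrite -(pair_big xpredT xpredT
    (fun i j => iota (c (i, j)) * (y ^+ i * z ^+ j))) /= exchange_big /=.
  apply: eq_bigr => j _; rewrite hornerZ hornerXn qy mulr_suml.
  by apply: eq_bigr => i _; rewrite mulrA.
have Greg m : inKQ iota Q G`_m.
  move=> v pv vQ; rewrite Gc; case: insub => [j|]; last exact: vge0.
  rewrite qy; apply: (vge_sum _ pv) => i _; apply: (vgeZ _ pv).
  by rewrite -[0](mul0rn _ i); apply: (vgeX _ pv); exact: yK.
exists (lead_coef G); split; first by rewrite lead_coef_eq0.
  by rewrite lead_coefE; exact: Greg.
by move=> v pv vQ; apply: (pole_denominator pv) => // m; exact: Greg.
Qed.

End Algebraic.

(** * Zeros and poles *)

Lemma leq_bigsum (I : finType) (f : I -> nat) i : (f i <= \sum_j f j)%N.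
Proof. by rewrite (bigD1 i) //= leq_addr. Qed.

Section Approximation.
Variables (K : finFieldType) (F : fieldType) (iota : {rmorphism K -> F}).

(** Units of [v] are units of [v'], so [v'] is a multiple of [v]. The factor [v' t] is nonnegative
    and divides 1, since [v'] also takes the value 1. *)
Lemma place_incl_eq v v' : is_place iota v -> is_place iota v' ->
  (forall x, x != 0 -> 0 <= v x -> 0 <= v' x) -> v = v'.
Proof.
move=> pv pv' incl.
have unit0 x : x != 0 -> v x = 0 -> v' x = 0.
  move=> x0 vx; have h1 : 0 <= v' x by apply: incl; rewrite ?vx.
  have : 0 <= v' x^-1 by apply: incl; rewrite ?invr_eq0 // (placeV _ pv) vx.
  by rewrite (placeV _ pv') oppr_ge0 => h2; apply/le_anti/andP.
have [t [t0 vt]] := place_uniformizer pv; have [s [s0 vs]] := place_uniformizer pv'.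
have scale x : x != 0 -> v' x = v x * v' t.
  move=> x0; case vx: (v x) => [k|k].
    have : v' (x / t ^+ k) = 0.
      apply: unit0; first by rewrite mulf_neq0 ?invr_eq0 ?expf_neq0.
      rewrite (placeM pv) ?invr_eq0 ?expf_neq0 // (placeV _ pv) (placeX _ _ pv) vt vx.
      by rewrite natz subrr.
    rewrite (placeM pv') ?invr_eq0 ?expf_neq0 // (placeV _ pv') (placeX _ _ pv').
    by move/subr0_eq => ->; rewrite -mulr_natl natz.
  have : v' (x * t ^+ k.+1) = 0.
    apply: unit0; first by rewrite mulf_neq0 ?expf_neq0.
    rewrite (placeM pv) ?expf_neq0 // (placeX _ _ pv) vt vx.
    by rewrite NegzE natz addNr.
  rewrite (placeM pv') ?expf_neq0 // (placeX _ _ pv') => /eqP.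
  by rewrite addr_eq0 => /eqP ->; rewrite -mulr_natl natz NegzE mulNr.
have t1 : v' t = 1.
  have := scale s s0; rewrite vs => /esym.
  have : 0 <= v' t by apply: incl; rewrite ?vt.
  case: (v' t) => [[|[|a]]|//] _; first by rewrite mulr0.
    by [].
  by case: (v s) => [[|b]|b] /(congr1 absz); rewrite abszM /= ?mul0n //; lia.
apply/funext => x; have [->|x0] := eqVneq x 0; last by rewrite scale // t1 mulr1.
by case: pv => -> *; case: pv' => -> *.
Qed.

Lemma separate_places v v' : is_place iota v -> is_place iota v' -> v <> v' ->
  exists z, [/\ z != 0, v z < 0 & 0 < v' z].
Proof.
move=> pv pv' vv'.
have one w w' : is_place iota w -> is_place iota w' -> w <> w' ->
    exists x, [/\ x != 0, 0 <= w x & w' x < 0].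
  move=> pw pw' ww'; apply: contrapT => no; apply: ww'.
  apply: (place_incl_eq pw pw') => x x0 wx; rewrite leNgt; apply/negP => w'x.
  by apply: no; exists x.
have [x [x0 vx v'x]] := one v v' pv pv' vv'.
have [y [y0 v'y vy]] := one v' v pv' pv (nesym vv').
exists (y / x); rewrite mulf_neq0 ?invr_eq0 //.
rewrite (placeM pv) ?invr_eq0 // (placeM pv') ?invr_eq0 // (placeV _ pv) (placeV _ pv').
by split=> //; lra.
Qed.

Lemma rational_frobenius v z : rational_place iota v -> vge v z 0 ->
  vge v (z ^+ #|K| - z) 1.
Proof.
move=> rv zv; have pv := proj1 rv; have [a ha] := rational_residue rv zv.
have -> : z ^+ #|K| - z = (z ^+ #|K| - iota a ^+ #|K|) - (z - iota a).
  by rewrite -rmorphXn expf_card opprB addrA addrNK.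
apply: (vgeB pv) => //; rewrite subrXX -[1]addr0; apply: (vgeM pv) => //.
apply: (vge_sum _ pv) => i _; rewrite -[0 : int]addr0; apply: (vgeM pv).
  by rewrite -[0 : int](mul0rn _ (#|K|.-1 - i)); apply: (vgeX _ pv).
by rewrite -[0 : int](mul0rn _ i); apply: (vgeX _ pv); apply: (vge_const _ pv).
Qed.

(* Since [X ^+ #|K| - X + 1] has no root in [K], the fraction below has no
   pole at any rational place. *)
Definition artin_fraction (z : F) : F := z ^+ #|K| / (1 + (z ^+ #|K| - z)).

Lemma artin_fraction_regular v z : rational_place iota v -> z != 0 -> 0 <= v z ->
  [/\ artin_fraction z != 0 & vge v (artin_fraction z) (v z)].
Proof.
move=> rv z0 zv; have pv := proj1 rv.
have [|v1 d0] := placeD_lt pv (oner_neq0 F) (y := z ^+ #|K| - z).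
  by rewrite (place1 pv) add0r; apply: rational_frobenius => //; right.
split; first by rewrite /artin_fraction mulf_neq0 ?invr_eq0 ?expf_neq0.
right; rewrite (placeM pv) ?invr_eq0 ?expf_neq0 // (placeV _ pv) v1 (place1 pv).
rewrite oppr0 addr0 (placeX _ _ pv) -(prednK (ltnW (finNzRing_gt1 K))) mulrS.
by rewrite lerDl mulrn_wge0.
Qed.

(** At a pole of [z], numerator and denominator are both dominated by [z ^+ #|K|], so the pole turns
    into a unit. *)
Lemma artin_fraction_pole v z : is_place iota v -> z != 0 -> v z < 0 ->
  artin_fraction z != 0 /\ v (artin_fraction z) = 0.
Proof.
move=> pv z0 zv; have zq0 : z ^+ #|K| != 0 by rewrite expf_neq0.
have [|vd d0] := placeD_lt pv zq0 (y := 1 - z).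
  apply: vge_le (_ : vge v (1 - z) (v z)) _.
    by apply: (vgeB pv); [apply: vge_le (vge1 pv) (ltW zv) | exact: vge_val].
  have -> : v (z ^+ #|K|) = v z + v z *+ #|K|.-1.
    by rewrite (placeX _ _ pv) -mulrS prednK // (ltnW (finNzRing_gt1 K)).
  have : v z *+ #|K|.-1 <= v z *+ 1.
    by apply: ler_wnMn2l; [exact: ltW |
      rewrite -ltnS prednK ?finNzRing_gt1 //; exact: ltnW (finNzRing_gt1 K)].
  rewrite mulr1n; move: zv (v z *+ _) => + b; rewrite -lezD1.
by lra.
have dE : 1 + (z ^+ #|K| - z) = z ^+ #|K| + (1 - z) by ring.
rewrite /artin_fraction dE mulf_neq0 ?invr_eq0 //; split=> //.
by rewrite (placeM pv) ?invr_eq0 // (placeV _ pv) vd subrr.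
Qed.

Section Independent.
Variables (n : nat) (P : 'I_n -> F -> int) (M : 'I_n -> nat).
Hypotheses (rP : forall j, rational_place iota (P j)) (injP : injective P).
Let pP j : is_place iota (P j) := proj1 (rP j).

(** A product over [l] of fractions built from a [z] with a pole at [P j] and a zero at [P l]: each
    is a unit at [P j], regular at every [P i] and zero at [P l]. *)
Lemma idempotent_approx j : exists e, [/\ e != 0, P j e = 0 &
  forall l, l != j -> vge (P l) e 1].
Proof.
have /choice[f hf] : forall l, exists f, [/\ f != 0, P j f = 0,
    (forall i, vge (P i) f 0) & l != j -> vge (P l) f 1].
  move=> l; have [->|lj] := eqVneq l j.
    exists 1; split=> //; [exact: oner_neq0 | exact: (place1 (pP j)) |].
    by move=> i; exact: (vge1 (pP i)).
  have [|z [z0 zj zl]] := separate_places (pP j) (pP l).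
    by move=> /injP jl; rewrite jl eqxx in lj.
  have [e0 ej] := artin_fraction_pole (pP j) z0 zj.
  exists (artin_fraction z); split=> // [i|_].
    have [zi|zi] := ltP (P i z) 0.
      by right; case: (artin_fraction_pole (pP i) z0 zi) => _ ->.
    by case: (artin_fraction_regular (rP i) z0 zi) => _ /vge_le; apply.
  case: (artin_fraction_regular (rP l) z0 (ltW zl)) => _ /vge_le; apply.
  by rewrite -gtz0_ge1.
exists (\prod_l f l); split.
- by apply/prodf_neq0 => l _; case: (hf l).
- rewrite (place_prod _ (pP j)) ?big1 // => l _; by case: (hf l).
move=> l lj; rewrite (bigD1 l) //= -[1 : int]addr0; apply: (vgeM (pP l)).
  by case: (hf l) => _ _ _; apply.
by apply: (vge_prod0 _ (pP l)) => i _; case: (hf i).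
Qed.

Lemma weak_approximation : exists u : 'I_n -> nat -> F,
  (forall j i, u j i != 0 /\ P j (u j i) = i) /\
  forall j i l, l != j -> vge (P l) (u j i) (M l).
Proof.
have /choice[e he] := idempotent_approx.
have /choice[t ht] := fun j => place_uniformizer (pP j).
pose C j := (\sum_l `|P l (t j)|)%N.
pose B := (\sum_l M l)%N.
have t'l j l : l != j -> vge (P l) (t j * e j ^+ C j) 0.
  move=> lj; have [_ _ /(_ l lj) el] := he j.
  apply: vge_le (_ : vge _ _ (P l (t j) + 1 *+ C j)) _.
    by apply: (vgeM (pP l)); [exact: vge_val | exact: (vgeX _ (pP l))].
  have : (`|P l (t j)| <= C j)%N by exact: (leq_bigsum _ l).
  by rewrite natz; lia.
(* [e j] is a unit at [P j], so the value there is [i]. Elsewhere [C j] is large enough to cancel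
   the poles of [t j], and [B] to reach every [M l]. *)
exists (fun j i => (t j * e j ^+ C j) ^+ i * e j ^+ B); split=> [j i|j i l lj].
  have [e0 ej _] := he j; have [t0 tj] := ht j.
  split; first by rewrite !(mulf_neq0, expf_neq0).
  rewrite (placeM (pP j)) ?(mulf_neq0, expf_neq0) // !(placeX _ _ (pP j)).
  rewrite (placeM (pP j)) ?(mulf_neq0, expf_neq0) // !(placeX _ _ (pP j)).
  by rewrite ej tj !mul0rn !addr0 natz.
have [_ _ /(_ l lj) el] := he j.
apply: vge_le (_ : vge _ _ (0 *+ i + 1 *+ B)) _.
  by apply: (vgeM (pP l)); [apply: (vgeX _ (pP l)); exact: t'l | exact: (vgeX _ (pP l))].
have : (M l <= B)%N by exact: (leq_bigsum _ l).
by rewrite mul0rn add0r natz lez_nat.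
Qed.

Let X := {j : 'I_n & 'I_(M j)}.

Lemma index_eq (x y : X) : tag x = tag y -> tagged x = tagged y :> nat -> x = y.
Proof.
case: x y => j i [j' i'] /= jj; case: j' / jj i' => i' /= ii.
by congr existT; exact: val_inj.
Qed.

(** Induction on the order: once the coefficients of order below [m] vanish, a nonzero term of order
    [m] with tag [j] is the only one of value [m] at [P j], all others being larger. The sum would
    then have value [m < M j]. *)
Lemma jets_independent (u : 'I_n -> nat -> F) (c : X -> K) :
  (forall j i, u j i != 0 /\ P j (u j i) = i) ->
  (forall j i l, l != j -> vge (P l) (u j i) (M l)) ->
  (forall j, vge (P j) (\sum_x iota (c x) * u (tag x) (tagged x)) (M j)) ->
  forall x, c x = 0.
Proof.
move=> uval uge sumM.
suff main (m : nat) (x : X) : nat_of_ord (tagged x) = m -> c x = 0 by move=> x; exact: main.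
elim/ltn_ind: m x => m IH x xm; apply: contrapT => /eqP cx.
pose j := tag x; have [ux0 ux] := uval j m.
have cux0 : iota (c x) * u j m != 0 by rewrite mulf_neq0 ?fmorph_eq0.
have vcux : P j (iota (c x) * u j m) = m.
  by rewrite (placeM (pP j)) ?fmorph_eq0 // (place_const _ (pP j)) add0r.
have mM : (m < M j)%N by rewrite -xm; exact: ltn_ord.
have := sumM j; rewrite (bigD1 x) //= xm.
set r := \sum_(_ | _) _; have hr : vge (P j) r (m%:Z + 1).
  apply: (vge_sum _ (pP j)) => y yx.
  have [ty|ty] := eqVneq (tag y) j; last first.
    apply: (vgeZ _ (pP j)); apply: vge_le (uge _ _ _ _) _; first by rewrite eq_sym.
    by rewrite -PoszD addn1 lez_nat.
  have [ltym|] := ltnP (tagged y) m.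
    by rewrite (IH _ ltym) // rmorph0 mul0r; exact: vge0.
  rewrite leq_eqVlt => /orP[/eqP my|ltmy].
    by rewrite (index_eq ty) ?eqxx // in yx; rewrite xm my.
  apply: (vgeZ _ (pP j)); right; move: (nat_of_ord _) ltmy => i mi; rewrite ty.
  case: (uval j i) => _ ->.
  by rewrite -PoszD addn1 lez_nat.
have [|vs s0] := placeD_lt (pP j) cux0 (y := r); first by rewrite vcux.
by move=> /(vge_neq0 s0); rewrite vs vcux lez_nat leqNgt mM.
Qed.

(* If [y] had more zeros than poles, the products of its powers with functions
   that are linearly independent modulo its zeros would be too numerous for
   [L(tQ)]. *)
Lemma zeros_le_poles (g : nat) Q y (w : nat) :
  function_field iota -> is_genus iota g -> rational_place iota Q ->
  (forall j, P j <> Q) -> inLmQ iota Q w y -> (forall j, vge (P j) y (M j)) ->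
  (w < \sum_j M j)%N -> y = 0.
Proof.
move=> ff hg rQ PQ [yK yQ] yP wM; have pQ := proj1 rQ.
apply: contrapT => /eqP y0.
(* The denominators below require a genuine pole at [Q]. Without one [y] is a nonzero constant, so
   every [M j] is 0, against [wM]. *)
have [Qy|Qy] := leP 0 (Q y).
  have [a ya] : exists a, y = iota a.
    apply: (regular_const ff hg rQ) => v pv.
    by have [->|vQ] := pselect (v = Q); [right | exact: yK].
  move: wM; rewrite big1 // => j _; have := yP j.
  by rewrite ya => -[yj|]; [rewrite -ya in yj; rewrite yj eqxx in y0 |
    rewrite (place_const _ (pP j)) lez_nat leqn0 => /eqP].
have [u [uval uge]] := weak_approximation.
have /choice[h hh] : forall x : X, exists h,
    [/\ h != 0, inKQ iota Q h & inKQ iota Q (h * u (tag x) (tagged x))].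
  by move=> x; exact: inKQ_common_denominator ff pQ yK Qy.
pose H := \prod_x h x.
have H0 : H != 0 by apply/prodf_neq0 => x _; case: (hh x).
have Hu (x : X) : inKQ iota Q (H * u (tag x) (tagged x)).
  move=> v pv vQ; rewrite /H (bigD1 x) //= mulrAC -[0 : int]addr0; apply: (vgeM pv).
    by case: (hh x) => _ _; apply.
  by apply: (vge_prod0 _ pv) => i _; case: (hh i) => _ + _; apply.
pose E := (\sum_(x : X) `|Q (H * u (tag x) (tagged x))%R|)%N.
(* These products lie in L(tQ) for t = E + (E + 1) w, and there are at least (E + 2)(w + 1) of them,
   which exceeds t + 1. *)
pose z (kx : 'I_E.+2 * X) := y ^+ kx.1 * (H * u (tag kx.2) (tagged kx.2)).
have [|kx|c [[kx ckx] sum0]] := LmQ_dependent ff hg rQ (t := E + E.+1 * w) (x := z).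
- rewrite card_prod card_ord card_tagged sumnE big_map.
  have -> : (\sum_(j <- enum 'I_n) #|'I_(M j)| = \sum_j M j)%N.
    by rewrite big_enum; apply: eq_bigr => j _; rewrite card_ord.
  by have := leq_mul (leqnn E.+2) wM; lia.
- split.
    move=> v pv vQ; rewrite -[0 : int]addr0; apply: (vgeM pv); last exact: Hu.
    by rewrite -[0 : int](mul0rn _ kx.1); apply: (vgeX _ pv); exact: yK.
  apply: vge_le (_ : vge Q _ ((- w%:Z) *+ kx.1 + Q (H * u (tag kx.2) (tagged kx.2)))) _.
    by apply: (vgeM pQ); [exact: (vgeX _ pQ) | exact: vge_val].
  have : (`|Q (H * u (tag kx.2) (tagged kx.2))%R| <= E)%N by exact: (leq_bigsum _ kx.2).
  have : (kx.1 * w <= E.+1 * w)%N by rewrite leq_mul2r -ltnS ltn_ord orbT.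
  by rewrite mulNrn -mulr_natr natz -PoszM mulnC; lia.
have sum0' : \sum_(k < E.+2) y ^+ k *
    \sum_x iota (c (k, x)) * u (tag x) (tagged x) = 0.
  apply: (mulfI H0); rewrite mulr0 -[RHS]sum0.
  rewrite [RHS](eq_bigr (fun p => iota (c (p.1, p.2)) * z (p.1, p.2))); last by case.
  rewrite -(pair_big xpredT xpredT (fun k x => iota (c (k, x)) * z (k, x))) /=.
  rewrite mulr_sumr; apply: eq_bigr => k _; rewrite mulr_sumr mulr_sumr.
  by apply: eq_bigr => x _; rewrite /z /=; ring.
(* Layers are removed from the lowest power of [y] upwards. All layers with [k > 0] vanish at each
   [P j] to order [M j], so [jets_independent] kills layer 0; then one factor [y] is cancelled.
   Indexing by [nat] lets the induction shift the layers. *)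
suff c0 T (d : nat -> X -> K) :
    \sum_(k < T) y ^+ k * \sum_x iota (d k x) * u (tag x) (tagged x) = 0 ->
    forall k x, (k < T)%N -> d k x = 0.
  have := c0 E.+2 (fun k x => c (inord k, x)) _ kx.1 kx.2 (ltn_ord _).
  rewrite inord_val; case: kx ckx => k x ckx /= cz.
  move: ckx; rewrite cz ?eqxx //.
  by under eq_bigr do rewrite inord_val.
elim: T d => [//|T IH] d; rewrite big_ord_recl expr0 mul1r /=.
set r := \sum_(_ < T) _ => sumd.
have rE : r = y * \sum_(k < T) y ^+ k * \sum_x iota (d k.+1 x) * u (tag x) (tagged x).
  by rewrite mulr_sumr; apply: eq_bigr => k _; rewrite mulrA -exprS.
have ureg j (x : X) : vge (P j) (u (tag x) (tagged x)) 0.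
  have [tj|tj] := eqVneq j (tag x); last exact: vge_le (uge _ _ _ tj) _.
  by right; rewrite tj; case: (uval (tag x) (tagged x)) => _ ->.
have d0 : forall x, d 0 x = 0.
  apply: (jets_independent uval uge) => j.
  have -> : \sum_x iota (d 0 x) * u (tag x) (tagged x) = - r.
    by apply/eqP; rewrite -addr_eq0 sumd.
  apply: (vgeN (pP j)); rewrite rE -[(M j)%:Z]addr0; apply: (vgeM (pP j)) => //.
  apply: (vge_sum _ (pP j)) => k _; rewrite -[0 : int]addr0; apply: (vgeM (pP j)).
    rewrite -[0 : int](mul0rn _ k); apply: (vgeX _ (pP j)).
    exact: yK (pP j) (PQ j).
  by apply: (vge_sum _ (pP j)) => x _; apply: (vgeZ _ (pP j)).
have : r = 0.
  by move: sumd; rewrite big1 ?add0r // => x _; rewrite d0 rmorph0 mul0r.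
rewrite rE => /eqP; rewrite mulf_eq0 (negPf y0) => /eqP/(IH (fun k => d k.+1)) dS.
by move=> [|k] x kT; [exact: d0 | exact: dS].
Qed.

End Independent.
End Approximation.

(** * Interpolation *)

(** Multiplicity [k] at a point imposes k(k + 1)/2 conditions; doubling avoids the division. *)
Lemma double_triangular (k : nat) : (2 * \sum_(i < k) (k - i) = k * k.+1)%N.
Proof.
elim: k => [|k IH]; first by rewrite big_ord0.
rewrite big_ord_recl subn0 (eq_bigr (fun i : 'I_k => k - i)%N) //.
by rewrite mulnDr IH; lia.
Qed.

Section Interpolation.
Variables (K : finFieldType) (F : fieldType) (iota : {rmorphism K -> F}).
Variables (g n m : nat) (P : 'I_n -> F -> int) (Q : F -> int).
Hypotheses (ff : function_field iota) (hg : is_genus iota g)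
  (rP : forall j, rational_place iota (P j)) (rQ : rational_place iota Q)
  (PQ : forall j, P j <> Q).
Let pP j : is_place iota (P j) := proj1 (rP j).
Let pQ : is_place iota Q := proj1 rQ.

(** The coefficient of Y^i ranges over L(((a - i) m + b) Q), which keeps the weight at most a m + b.
    The hypothesis compares twice the sum of Riemann's lower bounds with twice the number of
    conditions; a negative lower bound does no harm, being still below the dimension. *)
Lemma interpolation_exists (Mu : K -> 'I_n -> nat) (a b : nat) :
  ((\sum_(i < a.+1) (((a - i) * m + b)%:Z + 1 - g%:Z)) * 2 >
     (\sum_(z : K) \sum_(j < n) Mu z j * (Mu z j).+1)%N%:Z :> int) ->
  exists A : {poly F}, [/\ A != 0, interp_ok iota P Q Mu A &
     wval_le Q m A (a * m + b)%:Z].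
Proof.
move=> count.
pose t (i : 'I_a.+1) := ((a - i) * m + b)%N.
have /choice[l hl] := fun i => riemann_LmQ ff hg rQ (t i).
pose bs i := projT1 (cid (proj2 (hl i))).
have bsP i : [/\ forall k, inLmQ iota Q (t i) (bs i k),
    indep_mod iota (bs i) (@is_zero F) & span_mod iota (bs i) (inLmQ iota Q (t i)) (@is_zero F)].
  by rewrite /bs; case: cid.
pose X := {i : 'I_a.+1 & 'I_(l i)}.
pose Z := {zj : K * 'I_n & 'I_(Mu zj.1 zj.2)}.
(* The Y^k coefficient of A(Y + z) must vanish at P_j to order [Mu z j - k]; [shift] holds the
   coefficients of (Y + z)^i, which make this linear in the unknowns. *)
pose r (z : Z) := (Mu (tag z).1 (tag z).2 - tagged z)%N.
pose shift (z : K) (i k : nat) := (('X + z%:P) ^+ i : {poly K})`_k.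
pose mono (z : Z) (x : X) :=
  iota (shift (tag z).1 (tag x) (tagged z)) * bs (tag x) (tagged x).
have jets (z : Z) : exists e : X -> 'I_(r z) -> K, forall c : X -> K,
    (forall k, \sum_x c x * e x k = 0) ->
    vge (P (tag z).2) (\sum_x iota (c x) * mono z x) (r z)%:Z.
  apply: jet_conditions => // x; rewrite /mono; apply: (vgeZ _ (pP (tag z).2)).
  by have [/(_ (tagged x)) [bK _] _ _] := bsP (tag x); exact: bK (pP (tag z).2) (@PQ _).
pose e z := projT1 (cid (jets z)).
pose Y := {z : Z & 'I_(r z)}.
have [|c [[x0 cx0] hc]] := @linear_system_solution K X Y
    (fun (x : X) (y : Y) => e (tag y) x (tagged y)).
  have cX : #|{: X}| = (\sum_i l i)%N.
    rewrite card_tagged sumnE big_map big_enum.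
    by apply: eq_bigr => i _; rewrite card_ord.
  have cY : (#|{: Y}| * 2 = \sum_(z : K) \sum_(j < n) Mu z j * (Mu z j).+1)%N.
    rewrite card_tagged sumnE big_map big_enum /=.
    rewrite (eq_bigr r); last by move=> z _; rewrite card_ord.
    rewrite -(sig_big_dep xpredT (fun=> xpredT)
      (fun (zj : K * 'I_n) (i : 'I_(Mu zj.1 zj.2)) => Mu zj.1 zj.2 - i)%N) /=.
    rewrite pair_big /= mulnC big_distrr /=.
    by apply: eq_bigr => zj _; rewrite double_triangular.
  have le_l : \sum_(i < a.+1) (((a - i) * m + b)%:Z + 1 - g%:Z) <= (\sum_i l i)%N%:Z :> int.
    rewrite -[Posz (\sum_i l i)]natz natr_sum; apply: ler_sum => i _.
    by have [+ _] := hl i; rewrite natz /t; lra.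
  rewrite cX -(ltn_pmul2r (isT : 0 < 2)%N) cY -ltz_nat PoszM.
  by apply: lt_le_trans count _; rewrite ler_pM2r.
have hc0 z k : \sum_x c x * e z x k = 0 by have := hc (Tagged (fun z => 'I_(r z)) k).
pose C (i : 'I_a.+1) (k : 'I_(l i)) : K := c (Tagged (fun i => 'I_(l i)) k).
pose coe i := \sum_(k < l i) iota (C i k) * bs i k.
have coeL i : inLmQ iota Q (t i) (coe i).
  have [bL _ _] := bsP i; split=> [v pv vQ|].
    apply: (vge_sum _ pv) => k _; apply: (vgeZ _ pv).
    by case: (bL k) => bK _; exact: bK v pv vQ.
  by apply: (vge_sum _ pQ) => k _; apply: (vgeZ _ pQ); case: (bL k).
pose A := \sum_(i < a.+1) coe i *: 'X^i : {poly F}.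
have Ac (k : nat) : A`_k = if insub k is Some i then coe i else 0.
  rewrite coef_sum; case: insubP => [i _ ik|kT].
    rewrite (bigD1 i) //= coefZ coefXn ik eqxx mulr1 big1 ?addr0 // => j ji.
    rewrite coefZ coefXn -ik; case: eqP => [/ord_inj ij|_]; last exact: mulr0.
    by rewrite ij eqxx in ji.
  rewrite big1 // => i _; rewrite coefZ coefXn; case: eqP => [ki|_]; last exact: mulr0.
  by move: kT; rewrite ki ltn_ord.
have AK i : inKQ iota Q A`_i.
  move=> v pv vQ; rewrite Ac; case: insub => [j|]; last exact: vge0.
  by case: (coeL j) => cK _; exact: cK v pv vQ.
exists A; split.
- apply/eqP => A0; case: x0 cx0 => i k; apply/negP; rewrite negbK; apply/eqP.
  have [_ bi _] := bsP i; apply: (bi (C i)).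
  by have := Ac i; rewrite valK A0 coef0 => /esym.
- split=> // z j i.
  have shiftE : (A \Po ('X + (iota z)%:P))`_i =
      \sum_(x : X) iota (c x) * (iota (shift z (tag x) i) * bs (tag x) (tagged x)).
    transitivity (\sum_u \sum_k iota (C u k) * (iota (shift z u i) * bs u k)); last first.
      by rewrite sig_big_dep /=; apply: eq_bigr => -[].
    rewrite rmorph_sum coef_sum; apply: eq_bigr => u _.
    rewrite /= comp_polyZ comp_Xn_poly coefZ mulr_suml; apply: eq_bigr => k _.
    rewrite /shift -coef_map rmorphXn rmorphD /= map_polyX map_polyC /=; ring.
  (* From index [Mu z j] on, the required order is nonpositive and regularity at [P j] suffices. *)
  have [iMu|iMu] := ltnP i (Mu z j); last first.
    have le0 : (Mu z j)%:Z - i%:Z <= 0 by rewrite subr_le0 lez_nat.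
    apply: vge_le le0; rewrite shiftE.
    apply: (vge_sum _ (pP j)) => x _; do 2!apply: (vgeZ _ (pP j)).
    by have [/(_ (tagged x)) [bK _] _ _] := bsP (tag x); exact: bK (pP j) (@PQ j).
  pose zi : Z := Tagged (fun zj : K * 'I_n => 'I_(Mu zj.1 zj.2)) (i := (z, j)) (Ordinal iMu).
  have := projT2 (cid (jets zi)) c (hc0 zi).
  by rewrite shiftE /r /= -subzn // ltnW.
move=> k; rewrite Ac; case: insubP => [i _ <-|]; last by rewrite eqxx.
move=> ci0; have [_ /(vge_neq0 ci0)] := coeL i.
have ia : (i <= a)%N by rewrite -ltnS.
have -> : (a * m + b)%N = (t i + i * m)%N by rewrite /t addnAC -mulnDl subnK.
by rewrite PoszD; lra.
Qed.

(** Expand A around Y = c_j: in A(f), a coefficient of order at least M(c_j, j) - i multiplies (f -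
    c_j)^i, of order at least i. The weight of A bounds the pole of A(f) at [Q] by [w]. *)
Lemma interpolation_root (Mu : K -> 'I_n -> nat) (A : {poly F}) (w : nat) f (c : 'I_n -> K) :
  injective P -> interp_ok iota P Q Mu A -> wval_le Q m A w%:Z ->
  encodes iota P Q m f c -> (w < \sum_j Mu (c j) j)%N -> root A f.
Proof.
move=> injP [AK AP] Aw [[fK fQ] fc] wM; apply/eqP.
apply: (zeros_le_poles (M := fun j => Mu (c j) j) rP injP ff hg rQ PQ _ _ wM) => [|j].
  rewrite horner_coef; split=> [v pv vQ|].
    apply: (vge_sum _ pv) => i _; rewrite -[0 : int]addr0; apply: (vgeM pv); first exact: AK.
    by rewrite -[0 : int](mul0rn _ i); apply: (vgeX _ pv); exact: fK.
  apply: (vge_sum _ pQ) => i _.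
  have [->|Ai0] := eqVneq A`_i 0; first by rewrite mul0r; left.
  apply: vge_le (_ : vge Q _ (Q A`_i + (- m%:Z) *+ i)) _.
    by apply: (vgeM pQ); [exact: vge_val | exact: (vgeX _ pQ)].
  have := Aw i Ai0.
  by rewrite mulNrn -mulr_natr natz -PoszM mulnC; lra.
have -> : A.[f] = (A \Po ('X + (iota (c j))%:P)).[f - iota (c j)].
  by rewrite horner_comp hornerD hornerX hornerC subrK.
rewrite horner_coef; apply: (vge_sum _ (pP j)) => i _.
have -> : (Mu (c j) j)%:Z = (Mu (c j) j)%:Z - i%:Z + 1 *+ i by rewrite natz subrK.
by apply: (vgeM (pP j)); [exact: AP | apply: (vgeX _ (pP j)); exact: fc].
Qed.

End Interpolation.

(** * Real estimates *)

Lemma sum_arith_progression (a m b g : nat) :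
  (\sum_(i < a.+1) (((a - i) * m + b)%:Z + 1 - g%:Z)) * 2 =
  a.+1%:Z * (a%:Z * m%:Z + 2 * (b%:Z + 1) - 2 * g%:Z).
Proof.
elim: a => [|a IH]; first by rewrite big_ord1 subn0 mul0n add0n; ring.
rewrite big_ord_recl subn0.
rewrite (eq_bigr (fun i : 'I_a.+1 => ((a - i) * m + b)%:Z + 1 - g%:Z)) //.
by rewrite mulrDl IH PoszD PoszM -[a.+2]addn1 -[a.+1]addn1 !PoszD; ring.
Qed.

Lemma sqr_sum_le (R : realFieldType) (I : finType) (f : I -> R) :
  (\sum_i f i) ^+ 2 <= #|I|%:R * \sum_i f i ^+ 2.
Proof.
set S := \sum_i f i; set N := #|I|%:R.
have [I0|I0] := posnP #|I|.
  rewrite /S big1 ?expr0n /= ?mulr_ge0 ?ler0n ?sumr_ge0 // => [i _|i _].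
    exact: sqr_ge0.
  by have := card0_eq I0 i.
have N0 : 0 < N by rewrite ltr0n.
have : 0 <= \sum_i (N * f i - S) ^+ 2 by apply: sumr_ge0 => i _; exact: sqr_ge0.
have -> : \sum_i (N * f i - S) ^+ 2 = N * (N * \sum_i f i ^+ 2 - S ^+ 2).
  have -> : \sum_i (N * f i - S) ^+ 2 =
      \sum_i (N ^+ 2 * f i ^+ 2 + (- 2 * N * S) * f i + S ^+ 2).
    by apply: eq_bigr => i _; ring.
  rewrite !big_split /= -!mulr_sumr -/S sumr_const -mulr_natr -/N.
  ring.
by rewrite pmulr_rge0 // subr_ge0.
Qed.

Section RealBounds.
Variable R : realType.

(** As t^2 - 2 g t increases for t >= g, [W] may be replaced by the integer x = a m + b + 1. The
    right-hand side times m exceeds x^2 - 2 g x - 2 m g by a m^2 + (b + 1) m + (b + 1)(m - (b + 1))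
    + 2 g (b + 1), which is nonnegative because b < m. *)
Lemma interpolation_count (m g a b : nat) (C W : R) :
  (b < m)%N -> g%:R <= W -> W < (a * m + b).+1%:R ->
  W ^+ 2 - 2 * g%:R * W = 2 * m%:R * (C + g%:R) ->
  2 * C < a.+1%:R * (a%:R * m%:R + 2 * (b%:R + 1) - 2 * g%:R).
Proof.
move=> bm gW Wx WC.
have m0 : 0 < m%:R :> R by rewrite ltr0n (leq_ltn_trans _ bm).
rewrite -(ltr_pM2l m0).
have bm' : b%:R + 1 <= m%:R :> R by rewrite natr1 ler_nat.
have b0 : 0 <= b%:R :> R by [].
have g0 : 0 <= g%:R :> R by [].
have a0 : 0 <= a%:R :> R by [].
move: Wx; rewrite -natr1 natrD natrM -[a.+1%:R]natr1.
move: WC bm' b0 g0 a0 gW m0.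
move: (m%:R : R) (g%:R : R) (a%:R : R) (b%:R : R) => M G A B.
move=> WC BM B0 G0 A0 GW M0 Wx.
have : W ^+ 2 - 2 * G * W < (A * M + B + 1) ^+ 2 - 2 * G * (A * M + B + 1).
  rewrite -subr_gt0.
  have -> : (A * M + B + 1) ^+ 2 - 2 * G * (A * M + B + 1) - (W ^+ 2 - 2 * G * W)
    = (A * M + B + 1 - W) * ((A * M + B + 1 - G) + (W - G)) by ring.
  by apply: mulr_gt0; lra.
rewrite WC => lt1.
have AM : 0 <= A * M ^+ 2 by rewrite mulr_ge0 // sqr_ge0.
have GB : 0 <= G * (B + 1) by rewrite mulr_ge0 //; lra.
have BB : 0 <= (B + 1) * (M - (B + 1)) by rewrite mulr_ge0 //; lra.
have BM' : 0 <= (B + 1) * M by rewrite mulr_ge0 //; lra.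
nra.
Qed.

(** To be used with [x] the norm of M, [y] the sum of its entries and N = q n. The last hypothesis
    gives y <= sqrt(N) x, and x^2 + sqrt(N) x < (x + sqrt(N)/2)^2. *)
Lemma norm_lower_bound (C x y N : R) : 0 <= x -> 0 < N -> 0 <= C ->
  2 * C = x ^+ 2 + y -> y ^+ 2 <= N * x ^+ 2 ->
  Num.sqrt (2 * C) - Num.sqrt N / 2 < x.
Proof.
move=> x0 N0 C0 Cxy yx; rewrite ltNge; apply/negP => xle.
set D := Num.sqrt (2 * C) in xle *; set r := Num.sqrt N in xle *.
have D2 : D ^+ 2 = 2 * C by rewrite sqr_sqrtr // mulr_ge0.
have r2 : r ^+ 2 = N by rewrite sqr_sqrtr // ltW.
have r0 : 0 < r by rewrite sqrtr_gt0.
have yrx : y <= r * x.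
  have [y0|y0] := ltP y 0; first by apply: le_trans (ltW y0) _; rewrite mulr_ge0 // ltW.
  by rewrite -ler_sqr ?nnegrE ?mulr_ge0 ?(ltW r0) // exprMn r2.
have : (x + r / 2) ^+ 2 <= D ^+ 2.
  rewrite ler_sqr ?nnegrE ?sqrtr_ge0 //; first by lra.
  by rewrite addr_ge0 // divr_ge0 // ltW.
rewrite D2 Cxy; nra.
Qed.

(** With a = l - gt and h = sqrt(2 gt), squaring reduces the case a > h to gt (gt + 4) <= 2 a h. The
    hypothesis on [L] gives a^2 >= gt (gt + 4), and gt <= 4 gives gt + 4 <= 8, so that (2 a h)^2 = 8
    gt a^2 is large enough. *)
Lemma sqrt_shift_bound (gt L l : R) : 0 <= gt <= 4 -> 0 < L <= l ->
  0 < L ^+ 2 - 2 * gt * L - 4 * gt ->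
  l - gt - Num.sqrt (2 * gt) <= Num.sqrt (l ^+ 2 - 2 * gt * l - 2 * gt).
Proof.
move=> /andP[gt0 gt4] /andP[L0 Ll] Lgt.
set h := Num.sqrt (2 * gt); set a := l - gt.
have h0 : 0 <= h by exact: sqrtr_ge0.
have h2 : h ^+ 2 = 2 * gt by rewrite sqr_sqrtr // mulr_ge0.
have [ah|ha] := leP a h; first by apply: le_trans (sqrtr_ge0 _); lra.
have L2 : 2 * gt < L.
  rewrite ltNge; apply/negP => Lg; have : L * L <= 2 * gt * L by rewrite ler_wpM2r // ltW.
  by rewrite -expr2; lra.
have a2 : gt ^+ 2 + 4 * gt <= a ^+ 2.
  have : 0 <= (l - L) * ((l - gt) + (L - gt)) by rewrite mulr_ge0 //; lra.
  by rewrite /a; nra.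
have a0 : 0 <= a by rewrite /a; lra.
have key : gt * (gt + 4) <= 2 * a * h.
  have ah0 : 0 <= 2 * a * h by rewrite !mulr_ge0.
  have gt40 : 0 <= gt * (gt + 4) by rewrite mulr_ge0 ?addr_ge0.
  rewrite -ler_sqr ?nnegrE //.
  have -> : (2 * a * h) ^+ 2 = 8 * gt * a ^+ 2 by rewrite !exprMn h2; ring.
  have -> : (gt * (gt + 4)) ^+ 2 = (gt ^+ 2 + 4 * gt) * (gt * (gt + 4)) by ring.
  apply: le_trans (_ : 8 * gt * (gt ^+ 2 + 4 * gt) <= _).
    rewrite mulrC ler_wpM2r //; first by rewrite addr_ge0 ?sqr_ge0 ?mulr_ge0.
    by rewrite mulrC ler_wpM2r //; lra.
  by rewrite ler_wpM2l // mulr_ge0.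
have -> : l ^+ 2 - 2 * gt * l - 2 * gt = a ^+ 2 - gt ^+ 2 - 2 * gt by rewrite /a; ring.
have : Num.sqrt ((a - h) ^+ 2) <= Num.sqrt (a ^+ 2 - gt ^+ 2 - 2 * gt).
  by apply: ler_wsqrtr; nra.
by rewrite sqrtr_sqr ger0_norm // subr_ge0 ltW.
Qed.

(* With [Z = L * bsq gt L] the hypothesis on [B = bfactor rt gt q L] reads
   [B * (Z - kappa - 1 / rt) = Z + gt + sqrt (2 * gt)]. *)
Lemma bfactor_bound (rt gt q L l : R) : 0 <= gt <= 4 -> 0 < rt -> 0 < L <= l ->
  0 < 1 - (2 * gt / L) * (1 + 2 / L) -> 0 < bden rt gt q L ->
  1 <= bfactor rt gt q L /\
  l + 1 / rt <= bfactor rt gt q L *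
    (Num.sqrt (l ^+ 2 - 2 * gt * l - 2 * gt) - Num.sqrt q / (2 * Num.sqrt rt)).
Proof.
move=> gt04 rt0 /andP[L0 Ll] pos den0.
have gt0 : 0 <= gt by case/andP: gt04.
set s := bsq gt L; have s0 : 0 < s by rewrite sqrtr_gt0.
set Z := L * s; have Z0 : 0 < Z by rewrite mulr_gt0.
set k := Num.sqrt q / (2 * Num.sqrt rt).
have k0 : 0 <= k by rewrite divr_ge0 ?mulr_ge0 ?sqrtr_ge0.
set A := gt + Num.sqrt (2 * gt); have A0 : 0 <= A by rewrite addr_ge0 ?sqrtr_ge0.
set r := 1 / rt; have r0 : 0 <= r by rewrite divr_ge0 // ltW.
set B := bfactor rt gt q L.
have denE : bden rt gt q L = (Z - k - r) / Z.
  by rewrite /bden -/s -/Z -/k -/r; field; rewrite gt_eqF.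
have ZkrI : 0 < Z - k - r by move: den0; rewrite denE pmulr_lgt0 // invr_gt0.
have BE : B = (Z + A) / (Z - k - r).
  rewrite /B /bfactor /bnum denE -/s -/Z -/A; field.
  by rewrite !gt_eqF.
have B1 : 1 <= B by rewrite BE ler_pdivlMr // mul1r; lra.
split=> //.
set p := Num.sqrt _.
have L2 : 0 < L ^+ 2 - 2 * gt * L - 4 * gt.
  have -> : L ^+ 2 - 2 * gt * L - 4 * gt = L ^+ 2 * (1 - (2 * gt / L) * (1 + 2 / L)).
    by field; rewrite gt_eqF.
  by rewrite mulr_gt0 // exprn_gt0.
have Z2 : Z ^+ 2 = L ^+ 2 - 2 * gt * L - 4 * gt.
  rewrite exprMn sqr_sqrtr; last exact: ltW.
  by field; rewrite gt_eqF.
have pZ : Z <= p.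
  rewrite -[Z]ger0_norm ?(ltW Z0) // -sqrtr_sqr; apply: ler_wsqrtr; rewrite Z2.
  have Lg : 2 * gt < L.
    rewrite ltNge; apply/negP => Lg; have : L * L <= 2 * gt * L by rewrite ler_wpM2r // ltW.
    by rewrite -expr2; lra.
  have : 0 <= (l - L) * ((l - gt) + (L - gt)) by rewrite mulr_ge0 //; lra.
  by nra.
have pA : l <= p + A.
  have := @sqrt_shift_bound gt L l gt04; rewrite L0 Ll => /(_ isT L2).
  by rewrite -/p /A; lra.
have Bk : B * (Z - k - r) = Z + A by rewrite BE divfK // gt_eqF.
(* Since B >= 1, the first and last products are at least [p - Z] and [r]; with [Bk] the total is at
   least p + A + r, and [pA] applies. *)
have -> : B * (p - k) = B * (p - Z) + B * (Z - k - r) + B * r by ring.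
rewrite Bk.
have : p - Z <= B * (p - Z) by rewrite ler_peMl // subr_ge0.
have : r <= B * r by rewrite ler_peMl.
by lra.
Qed.

Lemma bfactor_asymptotics (rt gt q : R) : 0 <= gt -> 0 <= rt ->
  exists C L0 : R, forall L : nat, L0 <= L%:R ->
    `|bfactor rt gt q L%:R - 1| <= C / L%:R.
Proof.
move=> gt0 rt0.
pose A := gt + Num.sqrt (2 * gt); have A0 : 0 <= A by rewrite addr_ge0 ?sqrtr_ge0.
pose k := Num.sqrt q / (2 * Num.sqrt rt) + 1 / rt.
have k0 : 0 <= k by rewrite addr_ge0 // divr_ge0 ?mulr_ge0 ?sqrtr_ge0.
(* 8 gt <= L makes the radicand at least 1/4, so Z >= L/2; 4 k <= L then gives Z - k >= L/4, and the
   difference is exactly (A + k)/(Z - k). *)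
exists (4 * (A + k)), (1 + 8 * gt + 4 * k) => n; move: (n%:R : R) => L hL.
have L1 : 1 <= L by lra.
have L0 : 0 < L by lra.
pose u := L^-1; have u0 : 0 < u by rewrite invr_gt0.
have Lu : L * u = 1 by rewrite mulfV // gt_eqF.
have gu : gt * u <= 1 / 8.
  by rewrite ler_pdivrMr //; lra.
have u1 : u <= 1 by rewrite invf_le1.
have s14 : 1 / 4 <= 1 - (2 * gt / L) * (1 + 2 / L).
  rewrite -/u; have : gt * u * (1 + 2 * u) <= 1 / 8 * 3.
    by apply: ler_pM; rewrite ?mulr_ge0 //; lra.
  by lra.
have s12 : 1 / 2 <= bsq gt L.
  have : Num.sqrt ((1 / 2) ^+ 2) <= bsq gt L.
    by apply: ler_wsqrtr; apply: le_trans s14; lra.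
  by rewrite sqrtr_sqr ger0_norm //; lra.
set s := bsq gt L in s12 *.
pose Z := L * s.
have ZL : L / 2 <= Z by rewrite /Z; apply: ler_wpM2l; [exact: ltW | lra].
have Zk : L / 4 <= Z - k by lra.
have Z0 : 0 < Z by lra.
have Zk0 : 0 < Z - k by lra.
have -> : bfactor rt gt q L - 1 = (A + k) / (Z - k).
  rewrite /bfactor /bnum /bden -/s -/Z -/A -/k.
  by field; rewrite !gt_eqF // mulNr mul1r.
have Ak0 : 0 <= (A + k) / (Z - k) by apply: divr_ge0; lra.
rewrite ger0_norm //.
rewrite ler_pdivrMr // mulrAC ler_pdivlMr //.
have : 0 <= (A + k) * (4 * (Z - k) - L) by apply: mulr_ge0; lra.
by lra.
Qed.

End RealBounds.

(** * The decoding bound *)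

Section SoftDecoding.
Variables (R : realType) (K : finFieldType) (n : nat).
Variables (Pi : K -> 'I_n -> R) (Mu : K -> 'I_n -> nat) (lam : R) (J : K -> 'I_n -> R).
Hypotheses (lam0 : 0 < lam) (J01 : forall a j, 0 <= J a j <= 1)
  (MuE : forall a j, (Mu a j)%:R = lam * Pi a j - J a j).

Let sqM : R := \sum_(p : K * 'I_n) (Mu p.1 p.2)%:R ^+ 2.
Let sumM : R := \sum_(p : K * 'I_n) (Mu p.1 p.2)%:R.

Lemma cost_split : 2 * cost R Mu = sqM + sumM.
Proof.
rewrite /cost mulrC divfK ?pnatr_eq0 // pair_big -big_split /=.
by apply: eq_bigr => -[a j] _ /=; rewrite natrM -natr1; ring.
Qed.

Lemma cost_nat : 2 * cost R Mu = (\sum_(z : K) \sum_(j < n) Mu z j * (Mu z j).+1)%N%:R.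
Proof.
rewrite /cost mulrC divfK ?pnatr_eq0 // natr_sum.
by apply: eq_bigr => a _; rewrite natr_sum.
Qed.

Lemma cost_ge0 : 0 <= cost R Mu.
Proof.
by rewrite divr_ge0 // sumr_ge0 // => a _; rewrite sumr_ge0.
Qed.

Lemma multiplicity_norm_le : Num.sqrt sqM <= lam * Num.sqrt (frob Pi Pi).
Proof.
rewrite -[lam in leRHS]ger0_norm ?(ltW lam0) // -sqrtr_sqr -sqrtrM ?sqr_ge0 //.
apply: ler_wsqrtr; rewrite /frob pair_big mulr_sumr; apply: ler_sum => -[a j] _ /=.
have -> : lam ^+ 2 * (Pi a j * Pi a j) = (lam * Pi a j) ^+ 2 by ring.
have -> : lam * Pi a j = (Mu a j)%:R + J a j by rewrite MuE; ring.
have /andP[J0 _] := J01 a j.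
by rewrite ler_sqr ?nnegrE ?addr_ge0 // lerDl.
Qed.

Lemma multiplicity_score (c : 'I_n -> K) :
  lam * score Pi c - n%:R <= (\sum_j Mu (c j) j)%N%:R.
Proof.
rewrite natr_sum (eq_bigr (fun j => lam * Pi (c j) j - J (c j) j)) //.
rewrite sumrB -mulr_sumr lerD2l lerN2.
apply: le_trans (_ : \sum_(j < n) 1 <= _); last by rewrite sumr_const card_ord.
by apply: ler_sum => j _; case/andP: (J01 (c j) j).
Qed.

Lemma Lm_equation (g m : nat) : (0 < m)%N ->
  [/\ g%:R <= m%:R * Lm R g m Mu &
   (m%:R * Lm R g m Mu) ^+ 2 - 2 * g%:R * (m%:R * Lm R g m Mu) =
     2 * m%:R * (cost R Mu + g%:R)].
Proof.
move=> m0; have m0' : m%:R != 0 :> R by rewrite pnatr_eq0 -lt0n.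
have C0 := cost_ge0.
rewrite /Lm mulrC divfK //; set D := Num.sqrt _.
have D2 : D ^+ 2 = 2 * m%:R * (cost R Mu + g%:R) + g%:R ^+ 2.
  by rewrite sqr_sqrtr // addr_ge0 ?sqr_ge0 // !mulr_ge0 // addr_ge0.
split; first by rewrite lerDl sqrtr_ge0.
have -> : (g%:R + D) ^+ 2 - 2 * g%:R * (g%:R + D) = D ^+ 2 - g%:R ^+ 2 by ring.
by rewrite D2; ring.
Qed.

Lemma multiplicity_score_gt (g m L : nat) (c : 'I_n -> K) :
  (2 * g - 1 <= m)%N -> (0 < m)%N -> (0 < n)%N -> (0 < L)%N ->
  L%:R <= Lm R g m Mu -> reliability Pi ->
  let rt := m%:R / n%:R : R in let gt := g%:R / m%:R : R in
  let q := #|K|%:R : R in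
  0 < 1 - (2 * gt / L%:R) * (1 + 2 / L%:R) ->
  0 < bden rt gt q L%:R ->
  score Pi c / Num.sqrt (frob Pi Pi) >= Num.sqrt m%:R * bfactor rt gt q L%:R ->
  m%:R * Lm R g m Mu < (\sum_j Mu (c j) j)%N%:R.
Proof.
move=> gm m0 n0 L0 Ll rel rt gt q pos den0 hscore.
have m0' : 0 < m%:R :> R by rewrite ltr0n.
have n0' : 0 < n%:R :> R by rewrite ltr0n.
have q0 : 0 < q by rewrite /q (ltr0n R); exact: ltnW (finNzRing_gt1 K).
have rt0 : 0 < rt by rewrite divr_gt0.
have gt4 : 0 <= gt <= 4.
  rewrite /gt divr_ge0 //= ler_pdivrMr //; apply: le_trans (_ : m%:R <= _).
    by rewrite ler_nat; lia.
  by rewrite ler_peMl //; lra.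
have L0' : (0 : R) < L%:R <= Lm R g m Mu by rewrite ltr0n L0 Ll.
have [B1 key] := bfactor_bound gt4 rt0 L0' pos den0.
set B := bfactor _ _ _ _ in B1 key hscore; set l := Lm R g m Mu in Ll L0' key *.
have [_ eqW] := Lm_equation g m0; rewrite -/l in eqW.
have C0 := cost_ge0.
have mgt : m%:R * gt = g%:R by rewrite mulrC divfK // gt_eqF.
have C2 : 2 * cost R Mu = m%:R * (l ^+ 2 - 2 * gt * l - 2 * gt).
  apply: (mulfI (lt0r_neq0 m0')).
  have -> : m%:R * (m%:R * (l ^+ 2 - 2 * gt * l - 2 * gt)) =
     (m%:R * l) ^+ 2 - 2 * (m%:R * gt) * (m%:R * l) - 2 * m%:R * (m%:R * gt) by ring.
  by rewrite mgt eqW; ring.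
have sq0 : 0 <= sqM by apply: sumr_ge0 => p _; exact: sqr_ge0.
have qn0 : 0 < q * n%:R by rewrite mulr_gt0.
have := @norm_lower_bound _ (cost R Mu) (Num.sqrt sqM) sumM (q * n%:R).
rewrite sqr_sqrtr // cost_split => /(_ (sqrtr_ge0 _) qn0 C0 erefl) xgt.
have {xgt} xgt : Num.sqrt (sqM + sumM) - Num.sqrt (q * n%:R) / 2 < Num.sqrt sqM.
  apply: xgt; apply: le_trans (sqr_sum_le _) _.
  by rewrite card_prod card_ord natrM.
rewrite -cost_split C2 sqrtrM ?(ltW m0') // in xgt.
set p := Num.sqrt (l ^+ 2 - _ - _) in key xgt; set k := Num.sqrt q / _ in key.
have sm0 : 0 < Num.sqrt m%:R :> R by rewrite sqrtr_gt0.
have sm2 : Num.sqrt m%:R ^+ 2 = m%:R :> R by rewrite sqr_sqrtr // ltW.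
(* Measured in units of sqrt(m), the Cauchy-Schwarz loss is the term of [bden] that involves q. *)
have kE : Num.sqrt (q * n%:R) / 2 = Num.sqrt m%:R * k.
  have snV : Num.sqrt rt = Num.sqrt m%:R / Num.sqrt n%:R.
    by rewrite sqrtrM ?(ltW m0') // sqrtrV // ltW.
  rewrite /k snV sqrtrM ?(ltW q0) //; field.
  by rewrite !gt_eqF // sqrtr_gt0.
have Pi0 : 0 < Num.sqrt (frob Pi Pi).
  rewrite sqrtr_gt0; have [Pge Psum] := rel.
  have F0 : 0 <= frob Pi Pi.
    by apply: sumr_ge0 => a _; apply: sumr_ge0 => j _; rewrite mulr_ge0.
  rewrite lt_neqAle F0 andbT eq_sym; apply/eqP => frob0.
  pose j0 := Ordinal n0.
  have := Psum j0; rewrite big1 => [/eqP|a _]; first by rewrite eq_sym oner_eq0.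
  have row0 b : 0 <= \sum_(j < n) Pi b j * Pi b j.
    by apply: sumr_ge0 => j _; rewrite mulr_ge0.
  have rowE : \sum_(j < n) Pi a j * Pi a j = 0.
    by apply: (psumr_eq0P _ frob0) => // b _; exact: row0.
  have /eqP : Pi a j0 * Pi a j0 = 0.
    by apply: (psumr_eq0P _ rowE) => // j _; rewrite mulr_ge0.
  by rewrite mulf_eq0 orbb => /eqP.
apply: lt_le_trans (multiplicity_score c).
have B0 : 0 < B by lra.
have lowT : Num.sqrt sqM * (Num.sqrt m%:R * B) <= lam * score Pi c.
  apply: le_trans (_ : (lam * Num.sqrt (frob Pi Pi)) * (Num.sqrt m%:R * B) <= _).
    by rewrite ler_wpM2r ?multiplicity_norm_le // mulr_ge0 // ltW.
  rewrite -mulrA ler_wpM2l ?(ltW lam0) //.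
  by rewrite mulrC -ler_pdivlMr.
have lowx : (Num.sqrt m%:R * (p - k)) * (Num.sqrt m%:R * B) <
    Num.sqrt sqM * (Num.sqrt m%:R * B).
  rewrite ltr_pM2r; last by rewrite mulr_gt0.
  by move: xgt; rewrite kE; lra.
(* The [1 / rt] in [bfactor_bound] becomes n after scaling by m, which pays for the loss caused by
   [J] in the score. *)
have nE : m%:R * (1 / rt) = n%:R by rewrite /rt; field; rewrite !gt_eqF.
have : m%:R * (l + 1 / rt) <= m%:R * (B * (p - k)) by rewrite ler_wpM2l // ltW.
rewrite mulrDr nE => keym.
have eqx : (Num.sqrt m%:R * (p - k)) * (Num.sqrt m%:R * B) = m%:R * (B * (p - k)).
  by rewrite -[in RHS]sm2; ring.
rewrite eqx in lowx.
by lra.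
Qed.

End SoftDecoding.
Theorem theorem5 (K : finFieldType) (F : fieldType) (iota : {rmorphism K -> F})
    (g n m L : nat) (P : 'I_n -> F -> int) (Q : F -> int)
    (R : realType) (Pi : K -> 'I_n -> R)
    (Mu : K -> 'I_n -> nat) (lam : R) (J : K -> 'I_n -> R)
    (QM : {poly F}) (c : 'I_n -> K) :
  function_field iota ->
  is_genus iota g ->
  (forall j, rational_place iota (P j)) -> injective P ->
  rational_place iota Q -> (forall j, P j <> Q) ->
  (2 * g - 1 <= m)%N -> (m < n)%N ->
  reliability Pi ->
  (0 < L)%N ->
  (* M = lam Pi - J, J in [0,1], and L <= L_m(M) < L + 1 *)
  0 < lam -> (forall a j, 0 <= J a j <= 1) ->
  (forall a j, (Mu a j)%:R = lam * Pi a j - J a j) ->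
  L%:R <= Lm R g m Mu < L%:R + 1 ->
  is_interpolation iota P Q m Mu QM ->
  in_code iota P Q m c ->
  let rt := m%:R / n%:R : R in
  let gt := g%:R / m%:R : R in
  let q := #|K|%:R : R in
  (* the right-hand side is well defined *)
  0 < 1 - (2 * gt / L%:R) * (1 + 2 / L%:R) ->
  0 < bden rt gt q L%:R ->
  score Pi c / Num.sqrt (frob Pi Pi) >= Num.sqrt m%:R * bfactor rt gt q L%:R ->
  on_list iota P Q m QM c
  /\ (* bfactor = 1 + O(1/L), constant depending only on rt, gt, q *)
     exists C L0 : R, forall L' : nat, L0 <= L'%:R ->
       `|bfactor rt gt q L'%:R - 1| <= C / L'%:R.
Proof.
move=> ff hg rP injP rQ PQ gm mn rel L0 lam0 J01 MuE /andP[Ll _] [QM0 QMok QMmin] incode.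
move=> rt gt q pos den0 hscore; split; last first.
  by apply: bfactor_asymptotics; rewrite divr_ge0.
(* For m = 0 the division by zero would make [Lm] equal to 0, below [L]. *)
have m0 : (0 < m)%N.
  rewrite lt0n; apply/eqP => m0; move: Ll.
  by rewrite /Lm m0 invr0 mulr0 lern0 eqn0Ngt L0.
have [W0 eqW] := Lm_equation R Mu g m0.
have Sgt := multiplicity_score_gt lam0 J01 MuE gm m0
  (leq_ltn_trans (leq0n _) mn) L0 Ll rel pos den0 hscore.
set W := m%:R * _ in W0 eqW Sgt.
have /andP[wW Ww] := truncn_itv (le_trans (ler0n _ g) W0).
set w := Num.truncn W in wW Ww.
(* [a] bounds the Y-degree of the polynomial to be constructed, and [b < m] is the pole order left
   for its coefficient of Y^a. *)
have wE := divn_eq w m; set a := (w %/ m)%N in wE; set b := (w %% m)%N in wE.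
have [|A [A0 Aok Aw]] := interpolation_exists ff hg rP rQ PQ (m := m) (Mu := Mu) (a := a) (b := b).
  rewrite sum_arith_progression -(ltr_int R).
  have := interpolation_count (ltn_pmod w m0) W0 _ eqW; rewrite -/b cost_nat => /(_ a).
  rewrite -wE => /(_ Ww) lt2.
  by rewrite intrM intrB intrD !intrM intrD.
have [f fc] := incode; exists f; split=> //.
rewrite dvdp_XsubCl; apply: (interpolation_root ff hg rP rQ PQ injP QMok _ fc).
  by apply: QMmin A0 Aok _ _; exact: Aw.
rewrite -wE -(ltr_nat R); exact: le_lt_trans wW Sgt.
Qed.
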